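(* Let $\Upsilon=\Upsilon(\underline{\psi},\underline{\delta})$ be a triangular $\mathbf{t}$-module of dimension $n$ with no nilpotence such that $\operatorname{rk}\psi_i>1$ for $i=1,\dots,n$, and let $\Upsilon_l$ ($l=1,\dots,n$) be the $\mathbf{t}$-module given by the lower-right $l\times l$ block of $\Upsilon_t$ (so $\Upsilon_1=\psi_1$, $\Upsilon_n=\Upsilon$, and there are exact sequences $0\to\Upsilon_l\to\Upsilon_{l+1}\to\psi_{l+1}\to0$). Then: (i) the dual $\Upsilon^\vee$ is a $\mathbf{t}$-module possessing a $\tau$-co-composition series $\Upsilon_1^\vee\twoheadleftarrow\Upsilon_2^\vee\twoheadleftarrow\dots\twoheadleftarrow\Upsilon_n^\vee=\Upsilon^\vee$, i.e. there are exact sequences of $\mathbf{t}$-modules $0\to\psi_{l+1}^\vee\to\Upsilon_{l+1}^\vee\to\Upsilon_l^\vee\to0$ for $l=1,\dots,n-1$ with $\tau$-simple kernels $\psi^\vee_{l+1}$; (ii) there is an exact sequence of $\mathbf{t}$-modules $0\to\Upsilon^\vee\to\operatorname{Ext}^1_\tau(\Upsilon,C)\to\mathbb G_a^n\to0$; (iii) every morphism $f:\Upsilon\to\widehat\Upsilon$ of $\mathbf{t}$-modules both satisfying the hypotheses of this theorem induces a morphism $f^\vee:\widehat\Upsilon^\vee\to\Upsilon^\vee$.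
   Context: Let $A=\mathbb F_q[t]$, $K$ an $A$-field with $\theta$ the image of $t$, $K\{\tau\}$ the twisted polynomial ring ($\tau c=c^q\tau$), $\partial$ the constant term. A $\mathbf{t}$-module of dimension $d$ is an $\mathbb F_q$-algebra homomorphism $\Phi:A\to\mathrm{Mat}_d(K\{\tau\})$ with $\partial\Phi_t=\theta I_d+N$, $N$ nilpotent; it has no nilpotence if $N=0$. $C$ is the Carlitz module, $C_t=\theta+\tau$; $\mathbb G_a^n$ is the $\mathbf{t}$-module with $t\mapsto\theta I_n$. A Drinfeld module is a $\mathbf{t}$-module $\psi$ of dimension $1$ with $\psi_t=\theta+a_1\tau+\dots+a_r\tau^r$, $a_r\ne0$, $r\ge1$, $\operatorname{rk}\psi=r$. Triangular $\mathbf{t}$-module $\Upsilon(\underline\psi,\underline\delta)$: with rows and columns indexed $n,\dots,1$ from top to bottom and left to right, $\Upsilon_t$ is lower triangular with diagonal entry $\psi_{k,t}$ at $(k,k)$ for Drinfeld modules $\psi_k$, entry $\delta_{i\times j}\in K\{\tau\}$ in row $i$, column $j$ for $i<j$, zeros elsewhere. Exact sequences of $\mathbf{t}$-modules are those exact on Mordell–Weil groups; a $\mathbf{t}$-module is $\tau$-simple if it is not the middle term of a nontrivial short exact sequence. For $\mathbf{t}$-modules $\Phi$ (dim $d$), $\Psi$ (dim $e$): $\mathrm{Der}(\Phi,\Psi)\cong\mathrm{Mat}_{e\times d}(K\{\tau\})$ (biderivations, determined by their value $\delta_t$), $\mathrm{Der}_{in}(\Phi,\Psi)=\{U\Phi_t-\Psi_tU\}$,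 $\operatorname{Ext}^1_\tau(\Phi,\Psi)=\mathrm{Der}/\mathrm{Der}_{in}$, an $\mathbb F_q[t]$-module via $t*\delta=\Psi_t\delta$; it classifies extensions $0\to\Psi\to\Upsilon'\to\Phi\to0$ with $\Upsilon'_t=\begin{pmatrix}\Phi_t&0\\\delta_t&\Psi_t\end{pmatrix}$. The dual is $\Phi^\vee=\mathrm{Der}_0(\Phi,C)/\mathrm{Der}_{in,0}(\Phi,C)$, where $\mathrm{Der}_0$ consists of biderivations with $\partial\delta_t=0$ and $\mathrm{Der}_{in,0}=\mathrm{Der}_{in}\cap\mathrm{Der}_0$, with $t*\delta=C_t\delta$. ''Is a $\mathbf{t}$-module'' for such an $\mathbb F_q[t]$-module means it is (in a natural coordinate system given by reduced representatives of biderivations) the Mordell–Weil group of a $\mathbf{t}$-module. *)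

(* Defs.v *)
From HB Require Import structures.
From mathcomp Require Import all_boot all_order all_fingroup all_algebra.
From mathcomp Require Import all_solvable all_field.

Set Implicit Arguments.
Unset Strict Implicit.
Unset Printing Implicit Defensive.

Import GRing.Theory.
Local Open Scope ring_scope.

(* With A = {poly F} and F = F_q a finite field, an A-field is a field K with a
   ring morphism gamma : {poly F} -> K. *)

Definition theta (F : finFieldType) (K : fieldType)
  (gamma : {rmorphism {poly F} -> K}) : K := gamma 'X.

(* The twisted polynomial ring K{tau}. The element \sum_i a_i tau^i is stored
   as the polynomial \sum_i a_i 'X^i of its left coefficients. Coefficients,
   size and addition are those of {poly K}, but the multiplication is the
   twisted one, tau c = c^q tau with q = #|F|. *)

Definition tpoly (F : finFieldType) (K : fieldType)
  (gamma : {rmorphism {poly F} -> K}) : Type := {poly K}.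

HB.instance Definition _ (F : finFieldType) (K : fieldType)
  (gamma : {rmorphism {poly F} -> K}) := GRing.Zmodule.on (tpoly gamma).

Section TwistedRing.
Variables (F : finFieldType) (K : fieldType) (gamma : {rmorphism {poly F} -> K}).
Local Notation q := #|F|.
Local Notation Ktau := (tpoly gamma).

Definition tcoef (p : Ktau) (i : nat) : K := (p : {poly K})`_i.

Definition tmul (p r : Ktau) : Ktau :=
  \poly_(k < size (p : {poly K}) + size (r : {poly K}))
    \sum_(i < k.+1) tcoef p i * tcoef r (k - i) ^+ (q ^ i).

Fact exprD_card (x y : K) i : (x + y) ^+ (q ^ i) = x ^+ (q ^ i) + y ^+ (q ^ i).
Proof.
have [p pr_p pF] := finPcharP F.
have pK : p \in [pchar K].
  apply: (rmorph_pchar gamma).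
  exact: (rmorph_pchar (@polyC F)).
apply: exprDn_pchar; rewrite (eq_pnat _ (pcharf_eq pK)) pnatX; apply/orP; left.
have /abelem_pgroup := fin_ring_pchar_abelem pF.
by rewrite /pgroup cardsT.
Qed.

Fact q_gt0 i : (0 < q ^ i)%N.
Proof. by rewrite expn_gt0; apply/orP; left; apply/card_gt0P; exists 0. Qed.

Fact expr0_card i : (0 : K) ^+ (q ^ i) = 0.
Proof. by rewrite expr0n -leqn0 leqNgt q_gt0. Qed.

Fact exprsum_card (I : Type) (s : seq I) (P : pred I) (f : I -> K) i :
  (\sum_(j <- s | P j) f j) ^+ (q ^ i) = \sum_(j <- s | P j) f j ^+ (q ^ i).
Proof.
apply: (big_morph (fun x : K => x ^+ (q ^ i))); last exact: expr0_card.
by move=> x y; apply: exprD_card.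
Qed.

Lemma tpolyP (p r : Ktau) : (forall i, tcoef p i = tcoef r i) <-> p = r.
Proof. by split=> [e | -> //]; apply/polyP=> i; apply: e. Qed.

Fact tcoef_default (p : Ktau) i : (size (p : {poly K}) <= i)%N -> tcoef p i = 0.
Proof. exact: nth_default. Qed.

Fact tcoefC (c : K) i : tcoef (c%:P : {poly K}) i = if i == 0%N then c else 0.
Proof. exact: coefC. Qed.

Fact tcoefX i : tcoef ('X : {poly K}) i = (i == 1%N)%:R.
Proof. exact: coefX. Qed.

Lemma tcoef_mul (p r : Ktau) k :
  tcoef (tmul p r) k = \sum_(i < k.+1) tcoef p i * tcoef r (k - i) ^+ (q ^ i).
Proof.
rewrite {1}/tcoef coef_poly; case: ltnP => // le_k; rewrite big1 // => i _.
have [lt_i | le_i] := ltnP i (size (p : {poly K})); last first.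
  by rewrite (tcoef_default le_i) mul0r.
rewrite (_ : tcoef r _ = 0) ?expr0_card ?mulr0 //; apply: tcoef_default.
rewrite -(leq_add2l i) subnKC; last by rewrite -ltnS.
by apply: leq_trans le_k; rewrite leq_add2r ltnW.
Qed.

Fact tcoefD (p r : Ktau) i : tcoef (p + r) i = tcoef p i + tcoef r i.
Proof. exact: coefD. Qed.

Fact tmulA : associative tmul.
Proof.
move=> p r s; apply/tpolyP => n; rewrite !tcoef_mul.
pose c3 i m := tcoef p i * tcoef r (m - i) ^+ (q ^ i) * tcoef s (n - m) ^+ (q ^ m).
transitivity (\sum_(i < n.+1) \sum_(m < n.+1 | (i <= m)%N) c3 i m).
  apply: eq_bigr => i _; have le_in : (i <= n)%N by rewrite -ltnS.
  rewrite tcoef_mul exprsum_card mulr_sumr.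
  rewrite -(big_mkord xpredT (fun j => tcoef p i * (tcoef r j *
    tcoef s (n - i - j) ^+ (q ^ j)) ^+ (q ^ i))).
  rewrite -(big_mkord (fun m => i <= m)%N (fun m => c3 i m)).
  rewrite [RHS](@big_cat_nat _ _ _ i 0 n.+1) ?leqW //=.
  rewrite [X in _ = X + _]big_nat_cond [X in _ = X + _]big1 ?add0r; last first.
    by move=> j /andP[/andP[_ lt_ji]]; rewrite leqNgt lt_ji.
  rewrite (_ : \sum_(i <= m < n.+1 | _) _ =
    \sum_(0 + i <= m < n.+1 | (i <= m)%N) c3 i m) // big_addn subSn // [RHS]big_mkcond /=.
  rewrite !big_mkord; apply: eq_bigr => j _.
  by rewrite leq_addl /c3 addnK exprMn -exprM -expnD mulrA addnC subnDA.
rewrite (exchange_big_dep predT) //=; apply: eq_bigr => m _.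
rewrite tcoef_mul mulr_suml; have le_mn : (m <= n)%N by rewrite -ltnS.
rewrite -(big_mkord (fun i => i <= m)%N (fun i => c3 i m)).
rewrite -(big_mkord xpredT (fun i => tcoef p i * tcoef r (m - i) ^+ (q ^ i) *
    tcoef s (n - m) ^+ (q ^ m))).
rewrite [LHS](@big_cat_nat _ _ _ m.+1 0 n.+1) ?ltnS //= [X in _ + X]big_nat_cond.
rewrite [X in _ + X]big1 ?addr0.
  by rewrite big_nat_cond [RHS]big_nat_cond; apply: eq_bigl => i; rewrite ltnS andbT andbb.
by move=> j /andP[/andP[lt_mj _]]; rewrite leqNgt lt_mj.
Qed.

Fact tmul1p : left_id (1%:P : Ktau) tmul.
Proof.
move=> p; apply/tpolyP => n; rewrite tcoef_mul big_ord_recl /= big1 => [|i _].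
  by rewrite tcoefC /= mul1r subn0 addr0.
by rewrite tcoefC /= mul0r.
Qed.

Fact tmulp1 : right_id (1%:P : Ktau) tmul.
Proof.
move=> p; apply/tpolyP => n; rewrite tcoef_mul big_ord_recr /= big1 => [|i _].
  by rewrite tcoefC subnn eqxx expr1n mulr1 add0r.
by rewrite tcoefC subn_eq0 leqNgt ltn_ord /= expr0_card mulr0.
Qed.

Fact tmulDl : left_distributive tmul +%R.
Proof.
move=> p r s; apply/tpolyP => n; rewrite tcoefD !tcoef_mul -big_split /=.
by apply: eq_bigr => i _; rewrite tcoefD mulrDl.
Qed.

Fact tmulDr : right_distributive tmul +%R.
Proof.
move=> p r s; apply/tpolyP => n; rewrite tcoefD !tcoef_mul -big_split /=.
by apply: eq_bigr => i _; rewrite tcoefD exprD_card mulrDr.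
Qed.

Fact tpoly1_neq0 : (1%:P : Ktau) != 0.
Proof. exact: (oner_neq0 {poly K}). Qed.

HB.instance Definition _ := GRing.Zmodule_isNzRing.Build Ktau
  tmulA tmul1p tmulp1 tmulDl tmulDr tpoly1_neq0.

Definition tconst (c : K) : Ktau := (c%:P : {poly K}).
Definition tau : Ktau := ('X : {poly K}).

Lemma tau_comm c : tau * tconst c = tconst (c ^+ q) * tau.
Proof.
apply/tpolyP => n; rewrite [LHS]tcoef_mul [RHS]tcoef_mul.
rewrite [RHS]big_ord_recl [X in _ = _ + X]big1 ?addr0 => [|i _]; last first.
  by rewrite tcoefC mul0r.
rewrite tcoefC /= subn0 expr1 tcoefX.
case: n => [|n]; first by rewrite big_ord1 tcoefX mul0r mulr0.
rewrite 2!big_ord_recl tcoefX mul0r add0r big1 => [|i _]; last first.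
  by rewrite tcoefX mul0r.
rewrite tcoefX /= mul1r addr0 expn1 tcoefC subSS subn0.
by case: n => [|n]; rewrite ?mulr1 // -[q]expn1 expr0_card mulr0.
Qed.

(* The F-linear operator x |-> \sum_i p_i x^(q^i) defined by p. *)
Definition teval (p : Ktau) (x : K) : K :=
  \sum_(i < size (p : {poly K})) tcoef p i * x ^+ (q ^ i).

Definition mxeval e d (M : 'M[Ktau]_(e, d)) (x : 'cV[K]_d) : 'cV[K]_e :=
  \col_i \sum_j teval (M i j) (x j 0).

Definition mxconst e d (M : 'M[Ktau]_(e, d)) : 'M[K]_(e, d) :=
  map_mx (fun p => tcoef p 0) M.

(* An F-algebra morphism Phi : {poly F} -> 'M[K{tau}]_d is determined by the
   matrix Phi_t, which may be arbitrary, so a t-module is given by T = Phi_t. Its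
   Mordell-Weil group is 'cV[K]_d with t acting as mxeval T. *)

Definition is_tmodule d (T : 'M[Ktau]_d) : Prop :=
  exists N : 'M[K]_d,
    (exists k, N ^+ k = 0) /\ mxconst T = (theta gamma)%:M + N.

Definition no_nilpotence d (T : 'M[Ktau]_d) : Prop :=
  mxconst T = (theta gamma)%:M.

Definition carlitz : 'M[Ktau]_1 := (tconst (theta gamma) + tau)%:M.

Definition Gadd n : 'M[Ktau]_n := (tconst (theta gamma))%:M.

Definition is_morphism d e (T : 'M[Ktau]_d) (S : 'M[Ktau]_e)
  (f : 'M[Ktau]_(e, d)) : Prop := f *m T = S *m f.

(* Exactness of 0 -> T1 -> T -> T2 -> 0. *)
Definition short_exact d1 d d2 (T1 : 'M[Ktau]_d1) (T : 'M[Ktau]_d)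
    (T2 : 'M[Ktau]_d2) (f : 'M[Ktau]_(d, d1)) (g : 'M[Ktau]_(d2, d)) : Prop :=
  [/\ is_morphism T1 T f /\ is_morphism T T2 g,
      injective (mxeval f),
      forall y, mxeval g y = 0 <-> exists x, mxeval f x = y
    & forall z, exists y, mxeval g y = z].

Definition tau_simple d (T : 'M[Ktau]_d) : Prop :=
  forall d1 d2 (T1 : 'M[Ktau]_d1) (T2 : 'M[Ktau]_d2)
    (f : 'M[Ktau]_(d, d1)) (g : 'M[Ktau]_(d2, d)),
  is_tmodule T1 -> is_tmodule T2 -> short_exact T1 T T2 f g ->
  d1 = 0%N \/ d2 = 0%N.

Definition trank (p : Ktau) : nat := (size (p : {poly K})).-1.

Definition is_drinfeld (p : Ktau) : Prop :=
  tcoef p 0 = theta gamma /\ (1 <= trank p)%N.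

(* The matrix of Upsilon(psi, delta), of size n. Only the values psi k and
   delta i j with 1 <= i < j <= n and 1 <= k <= n matter. Row (or column) a of
   the matrix, counted from 0 at the top (or left), carries the index n - a. *)
Definition triangular (psi : nat -> Ktau) (delta : nat -> nat -> Ktau) n :
    'M[Ktau]_n :=
  \matrix_(a, b)
    if (n - a)%N == (n - b)%N then psi (n - a)%N
    else if (n - a < n - b)%N then delta (n - a)%N (n - b)%N else 0.

Lemma triangular_drsubmx psi delta m l :
  drsubmx (triangular psi delta (m + l)) = triangular psi delta l.
Proof. by apply/matrixP=> a b; rewrite !mxE /= !subnDl. Qed.

(* The maps in 0 -> Upsilon_l -> Upsilon_(l+1) -> psi_(l+1) -> 0. *)
Definition block_incl l : 'M[Ktau]_(l.+1, l) :=
  col_mx (0 : 'M[Ktau]_(1, l)) 1%:M.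

Definition block_proj l : 'M[Ktau]_(1, l.+1) :=
  row_mx 1%:M (0 : 'M[Ktau]_(1, l)).

(* The hypotheses on Upsilon(psi, delta). *)
Definition admissible (psi : nat -> Ktau) (delta : nat -> nat -> Ktau) n : Prop :=
  [/\ forall k, (1 <= k <= n)%N -> is_drinfeld (psi k),
      no_nilpotence (triangular psi delta n)
    & forall k, (1 <= k <= n)%N -> (1 < trank (psi k))%N].

(* Biderivations from T to S are identified with their values at t. *)

Definition der_in d e (T : 'M[Ktau]_d) (S : 'M[Ktau]_e)
    (D : 'M[Ktau]_(e, d)) : Prop :=
  exists U : 'M[Ktau]_(e, d), D = U *m T - S *m U.

Definition der0 e d (D : 'M[Ktau]_(e, d)) : Prop := mxconst D = 0.

Definition der_in0 d e (T : 'M[Ktau]_d) (S : 'M[Ktau]_e)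
    (D : 'M[Ktau]_(e, d)) : Prop := der_in T S D /\ der0 D.

(* Der and In are subgroups of 'M_(e, d) with In contained in Der, and Der / In is an
   F[t]-module with t acting as left multiplication by S. The F-linear map
   x |-> [coord x] identifies it with the Mordell-Weil group of P. *)
Definition MW_coordinates d e m (Der In : 'M[Ktau]_(e, d) -> Prop)
    (S : 'M[Ktau]_e) (coord : 'cV[K]_m -> 'M[Ktau]_(e, d))
    (P : 'M[Ktau]_m) : Prop :=
  [/\ forall x, Der (coord x),
      forall D, Der D -> exists! x, In (D - coord x)
    & forall x, In (S *m coord x - coord (mxeval P x))].

(* Reduced representatives of the classes of biderivations to the Carlitz
   module: the entry in column a has degree < r a in tau, and in the dual
   case it also has no constant term. *)

Definition ext_coord n (r : 'I_n -> nat) (x : 'cV[K]_(\sum_(a < n) r a)) :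
    'rV[Ktau]_n :=
  \row_a (\sum_(i < r a) submxcol x a i 0 *: 'X^i : {poly K}).

Definition dual_coord n (r : 'I_n -> nat) (x : 'cV[K]_(\sum_(a < n) (r a).-1)) :
    'rV[Ktau]_n :=
  \row_a (\sum_(i < (r a).-1) submxcol x a i 0 *: 'X^(i.+1) : {poly K}).

Definition diag_rank n (T : 'M[Ktau]_n) (a : 'I_n) : nat := trank (T a a).

Definition ext_dim n (T : 'M[Ktau]_n) : nat := (\sum_(a < n) diag_rank T a)%N.

Definition dual_dim n (T : 'M[Ktau]_n) : nat :=
  (\sum_(a < n) (diag_rank T a).-1)%N.

End TwistedRing.

(* Extensions L of K as A-fields. When K is finite, distinct twisted polynomials
   may define the same operator on K, so the Mordell-Weil group over K alone does
   not determine a t-module; the points over all extensions (K included) do. *)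

Definition Afield_ext (F : finFieldType) (K L : fieldType)
    (gamma : {rmorphism {poly F} -> K}) (gammaL : {rmorphism {poly F} -> L})
    (j : {rmorphism K -> L}) : Prop := forall a, gammaL a = j (gamma a).

Definition base_change (F : finFieldType) (K L : fieldType)
    (gamma : {rmorphism {poly F} -> K}) (gammaL : {rmorphism {poly F} -> L})
    (j : {rmorphism K -> L}) e d (M : 'M[tpoly gamma]_(e, d)) :
    'M[tpoly gammaL]_(e, d) :=
  map_mx (fun p : tpoly gamma => map_poly j (p : {poly K}) : tpoly gammaL) M.

Section Dual.
Variables (F : finFieldType) (K : fieldType) (gamma : {rmorphism {poly F} -> K}).
Local Notation Ktau := (tpoly gamma).

(* The t-module P is the dual of T. *)
Definition is_dual n (T : 'M[Ktau]_n) (P : 'M[Ktau]_(dual_dim T)) : Prop :=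
  is_tmodule P /\
  forall (L : fieldType) (gammaL : {rmorphism {poly F} -> L})
    (j : {rmorphism K -> L}), Afield_ext gamma gammaL j ->
  MW_coordinates (@der0 F L gammaL 1 n)
    (der_in0 (base_change gammaL j T) (carlitz gammaL)) (carlitz gammaL)
    (dual_coord gammaL (r := diag_rank T)) (base_change gammaL j P).

(* The t-module E is Ext^1_tau(T, C). *)
Definition is_ext n (T : 'M[Ktau]_n) (E : 'M[Ktau]_(ext_dim T)) : Prop :=
  is_tmodule E /\
  forall (L : fieldType) (gammaL : {rmorphism {poly F} -> L})
    (j : {rmorphism K -> L}), Afield_ext gamma gammaL j ->
  MW_coordinates (fun _ : 'rV[tpoly gammaL]_n => True)
    (der_in (base_change gammaL j T) (carlitz gammaL)) (carlitz gammaL)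
    (ext_coord gammaL (r := diag_rank T)) (base_change gammaL j E).

(* In coordinates, h is the map [D] |-> [D f] from the dual of T' to that of T
   induced by f : T -> T'. *)
Definition dual_induced n n' (T : 'M[Ktau]_n) (T' : 'M[Ktau]_n')
    (f : 'M[Ktau]_(n', n)) (h : 'M[Ktau]_(dual_dim T, dual_dim T')) : Prop :=
  forall (L : fieldType) (gammaL : {rmorphism {poly F} -> L})
    (j : {rmorphism K -> L}), Afield_ext gamma gammaL j ->
  forall x : 'cV[L]_(dual_dim T'),
  der_in0 (base_change gammaL j T) (carlitz gammaL)
    (dual_coord gammaL (r := diag_rank T') x *m base_change gammaL j f
     - dual_coord gammaL (r := diag_rank T) (mxeval (base_change gammaL j h) x)).

(* In coordinates, h is the map from the dual of T to Ext^1_tau(T, C) induced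
   by the inclusion of Der_0 in Der. *)
Definition dual_ext_inclusion n (T : 'M[Ktau]_n)
    (h : 'M[Ktau]_(ext_dim T, dual_dim T)) : Prop :=
  forall (L : fieldType) (gammaL : {rmorphism {poly F} -> L})
    (j : {rmorphism K -> L}), Afield_ext gamma gammaL j ->
  forall x : 'cV[L]_(dual_dim T),
  der_in (base_change gammaL j T) (carlitz gammaL)
    (dual_coord gammaL (r := diag_rank T) x
     - ext_coord gammaL (r := diag_rank T) (mxeval (base_change gammaL j h) x)).

(* In coordinates, g is the map from Ext^1_tau(T, C) to Ga^n sending the class of
   D to its constant term. *)
Definition ext_constant_term n (T : 'M[Ktau]_n)
    (g : 'M[Ktau]_(n, ext_dim T)) : Prop :=
  forall (L : fieldType) (gammaL : {rmorphism {poly F} -> L})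
    (j : {rmorphism K -> L}), Afield_ext gamma gammaL j ->
  forall x : 'cV[L]_(ext_dim T),
  mxeval (base_change gammaL j g) x
    = (mxconst (ext_coord gammaL (r := diag_rank T) x))^T.

End Dual.

Arguments is_dual {F K gamma n} T P.
Arguments is_ext {F K gamma n} T E.
Arguments dual_induced {F K gamma n n'} T T' f h.
Arguments dual_ext_inclusion {F K gamma n} T h.
Arguments ext_constant_term {F K gamma n} T g.

(* Main.v *)
(* Since rk psi_k >= 2, the product U psi_k has larger tau-degree than C_t U, so
   by subtracting inner biderivations U Upsilon_t - C_t U, last column first, every
   biderivation is brought to a unique form with entries of degree < rk psi_k in
   tau. The corrections are given by twisted polynomials in the coefficients, hence
   the action of t and the induced maps are matrices over K{tau}; identities
   between these matrices are checked on points over K(X). As Upsilon has no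
   nilpotence, inner biderivations have no constant term, and all the sequences are
   read off on reduced representatives.

   The dual of a Drinfeld module of rank r has dimension d = r - 1. Give weight
   k d + (d - 1 - i) to tau^k e_i (0 <= i < d) in its motive K{tau}^d: then tau
   raises weights by d and t by d + 1. As d and d + 1 are coprime, a nonzero m
   together with t m, ..., t^(d-1) m is independent over K{tau}, so a nonzero
   morphism g to a t-module of dimension d2 has d <= d2 and a finite kernel. In an
   exact sequence with both ends nonzero, K is then finite and g is bijective by
   counting points, a contradiction. *)

From HB Require Import structures.
Require Import Defs.
From mathcomp Require Import all_boot all_order all_fingroup all_algebra.
From mathcomp Require Import all_solvable all_field.
From mathcomp Require Import zify.

Set Implicit Arguments.
Unset Strict Implicit.
Unset Printing Implicit Defensive.

Import GRing.Theory.
Local Open Scope ring_scope.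

(** * Twisted polynomials and their operators *)

Section TwistedPolynomials.
Variables (F : finFieldType) (K : fieldType) (gamma : {rmorphism {poly F} -> K}).
Local Notation q := #|F|.
Local Notation Ktau := (tpoly gamma).
Local Notation tsize p := (size (p : {poly K})).
Implicit Types p r : Ktau.

Lemma tcoef0 i : tcoef (0 : Ktau) i = 0.
Proof. exact: coef0. Qed.

Lemma tcoefB p r i : tcoef (p - r) i = tcoef p i - tcoef r i.
Proof. exact: coefB. Qed.

Lemma tcoef_sum (I : Type) (s : seq I) (P : pred I) (f : I -> Ktau) i :
  tcoef (\sum_(j <- s | P j) f j) i = \sum_(j <- s | P j) tcoef (f j) i.
Proof.
by apply: (big_morph (fun p : Ktau => tcoef p i)) => [x y|];
  rewrite ?tcoefD ?tcoef0.
Qed.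

Lemma tcoef1 i : tcoef (1 : Ktau) i = (i == 0%N)%:R.
Proof. by rewrite [LHS]tcoefC; case: eqP. Qed.

Lemma tcoefM p r k :
  tcoef (p * r) k = \sum_(i < k.+1) tcoef p i * tcoef r (k - i) ^+ (q ^ i).
Proof. exact: tcoef_mul. Qed.

Lemma tcoef_tconst c i : tcoef (tconst gamma c) i = if i == 0%N then c else 0.
Proof. exact: tcoefC. Qed.

Lemma tcoef_constM c p k : tcoef (tconst gamma c * p) k = c * tcoef p k.
Proof.
rewrite tcoefM big_ord_recl big1 => [|i _]; last by rewrite tcoef_tconst mul0r.
by rewrite tcoef_tconst subn0 expn0 expr1 addr0.
Qed.

Lemma tcoef_tauM p k :
  tcoef (tau gamma * p) k = if k is k'.+1 then tcoef p k' ^+ q else 0.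
Proof.
rewrite tcoefM big_ord_recl [tcoef (tau gamma) _]tcoefX mul0r add0r.
case: k => [|k]; first by rewrite big_ord0.
rewrite big_ord_recl big1 => [|i _]; last by rewrite [tcoef _ _]tcoefX mul0r.
by rewrite [tcoef _ _]tcoefX /= mul1r addr0 expn1 subSS subn0.
Qed.

Lemma tcoef_tauXM s p k :
  tcoef (tau gamma ^+ s * p) k = if (s <= k)%N then tcoef p (k - s) ^+ (q ^ s) else 0.
Proof.
elim: s k => [|s IH] [|k]; rewrite ?expr0 ?mul1r ?subn0 ?expr1 //.
  by rewrite exprS -mulrA tcoef_tauM.
rewrite exprS -mulrA tcoef_tauM IH ltnS.
by case: ifP; rewrite ?subSS -?exprM -?expnSr // -[q]expn1 expr0_card.
Qed.

Lemma tcoef_tauX s k : tcoef (tau gamma ^+ s) k = (k == s)%:R.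
Proof.
rewrite -[_ ^+ s]mulr1 tcoef_tauXM tcoef1.
case: (ltngtP k s) => [//|lt_sk|->]; last by rewrite subnn expr1n.
by rewrite subn_eq0 leqNgt lt_sk expr0_card.
Qed.

Lemma tpoly_ext p r : (forall i, tcoef p i = tcoef r i) -> p = r.
Proof. by move=> e; apply/tpolyP. Qed.

Lemma tevalE N p x : (tsize p <= N)%N ->
  teval p x = \sum_(i < N) tcoef p i * x ^+ (q ^ i).
Proof.
move=> leN; rewrite /teval (big_ord_widen _ (fun i => tcoef p i * x ^+ (q ^ i)) leN).
rewrite big_mkcond; apply: eq_bigr => i _; case: ltnP => // le_i.
by rewrite tcoef_default // mul0r.
Qed.

Lemma tevalD p r x : teval (p + r) x = teval p x + teval r x.
Proof.
pose N := maxn (tsize p) (tsize r).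
have leN : (tsize (p + r)%R <= N)%N by apply: (size_polyD (p : {poly K}) r).
rewrite (tevalE _ leN) (tevalE _ (leq_maxl _ _ : (tsize p <= N)%N))
  (tevalE _ (leq_maxr _ _ : (tsize r <= N)%N)).
by rewrite -big_split; apply: eq_bigr => i _; rewrite tcoefD mulrDl.
Qed.

Lemma tevalDr p x y : teval p (x + y) = teval p x + teval p y.
Proof.
rewrite /teval -big_split; apply: eq_bigr => i _ /=.
by rewrite (exprD_card gamma) mulrDr.
Qed.

Lemma teval0 x : teval (0 : Ktau) x = 0.
Proof. by rewrite /teval size_poly0 big_ord0. Qed.

Lemma teval0r p : teval p 0 = 0.
Proof. by apply: big1 => i _; rewrite expr0_card mulr0. Qed.

Lemma teval_sum (I : Type) (s : seq I) (P : pred I) (f : I -> Ktau) x :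
  teval (\sum_(j <- s | P j) f j) x = \sum_(j <- s | P j) teval (f j) x.
Proof.
by apply: (big_morph (fun p : Ktau => teval p x)) => [u v|];
  rewrite ?tevalD ?teval0.
Qed.

Lemma teval_sumr (I : Type) (s : seq I) (P : pred I) p (f : I -> K) :
  teval p (\sum_(j <- s | P j) f j) = \sum_(j <- s | P j) teval p (f j).
Proof. by apply: (big_morph (teval p)) => [u v|]; rewrite ?tevalDr ?teval0r. Qed.

Lemma teval_const c x : teval (tconst gamma c) x = c * x.
Proof.
rewrite (@tevalE 1) ?size_polyC ?leq_b1 //.
by rewrite big_ord1 tcoef_tconst.
Qed.

Lemma teval1 x : teval (1 : Ktau) x = x.
Proof. by rewrite [LHS]teval_const mul1r. Qed.

Lemma teval_constM c p x : teval (tconst gamma c * p) x = c * teval p x.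
Proof.
have leN : (tsize (tconst gamma c * p)%R <= tsize p)%N.
  by apply/leq_sizeP => i lei; rewrite -/(tcoef _ i) tcoef_constM tcoef_default ?mulr0.
rewrite (tevalE _ leN) mulr_sumr; apply: eq_bigr => i _.
by rewrite tcoef_constM mulrA.
Qed.

Lemma teval_tauM p x : teval (tau gamma * p) x = teval p x ^+ q.
Proof.
have leN : (tsize (tau gamma * p)%R <= (tsize p).+1)%N.
  apply/leq_sizeP => -[|i] // lei; rewrite -/(tcoef _ _) tcoef_tauM.
  by rewrite tcoef_default // -[q]expn1 expr0_card.
rewrite (tevalE _ leN) big_ord_recl tcoef_tauM mul0r add0r.
have -> : teval p x ^+ q = teval p x ^+ (q ^ 1) by rewrite expn1.
rewrite /teval (exprsum_card gamma); apply: eq_bigr => i _.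
by rewrite tcoef_tauM expn1 exprMn -exprM -expnSr.
Qed.

Lemma teval_tau x : teval (tau gamma) x = x ^+ q.
Proof. by rewrite -[tau gamma]mulr1 teval_tauM teval1. Qed.

Lemma teval_tauXM s p x : teval (tau gamma ^+ s * p) x = teval p x ^+ (q ^ s).
Proof.
elim: s => [|s IH]; first by rewrite mul1r expr1.
by rewrite exprS -mulrA teval_tauM IH -exprM -expnSr.
Qed.

(** Splitting the left factor into monomials reduces the composition law [tevalM] to scalars and
    powers of [tau]. *)
Lemma tpoly_sum p : p = \sum_(i < tsize p) tconst gamma (tcoef p i) * tau gamma ^+ i.
Proof.
apply: tpoly_ext => k; rewrite tcoef_sum.
under eq_bigr => i _ do rewrite tcoef_constM tcoef_tauX.
have [ltk | lek] := ltnP k (tsize p); last first.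
  rewrite tcoef_default // big1 // => i _; case: eqP => [e|]; last by rewrite mulr0.
  by move: (ltn_ord i); rewrite -e ltnNge lek.
rewrite (bigD1 (Ordinal ltk)) //= eqxx mulr1 big1 ?addr0 // => i neq.
by case: eqP => [e|]; [case/eqP: neq; apply: val_inj | rewrite mulr0].
Qed.

Lemma tevalM p r x : teval (p * r) x = teval p (teval r x).
Proof.
rewrite {1}(tpoly_sum p) mulr_suml teval_sum; apply: eq_bigr => i _.
by rewrite -mulrA teval_constM teval_tauXM.
Qed.

Lemma tcoef_monoM c s p k :
  tcoef (tconst gamma c * tau gamma ^+ s * p) k
    = if (s <= k)%N then c * tcoef p (k - s) ^+ (q ^ s) else 0.
Proof.
by rewrite -mulrA tcoef_constM tcoef_tauXM; case: ifP; rewrite ?mulr0.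
Qed.

Lemma tconst0 : tconst gamma 0 = 0.
Proof. exact: polyC0. Qed.

Lemma tconst1 : tconst gamma 1 = 1.
Proof. by []. Qed.

Lemma tconstM c c' : tconst gamma (c * c') = tconst gamma c * tconst gamma c'.
Proof.
apply: tpoly_ext => k; rewrite tcoef_constM !tcoef_tconst.
by case: ifP; rewrite ?mulr0.
Qed.

Lemma mxevalE e d (M : 'M[Ktau]_(e, d)) x i :
  mxeval M x i 0 = \sum_j teval (M i j) (x j 0).
Proof. by rewrite mxE. Qed.

Lemma mxevalM e d c (M : 'M[Ktau]_(e, d)) (N : 'M[Ktau]_(d, c)) x :
  mxeval (M *m N) x = mxeval M (mxeval N x).
Proof.
apply/colP => i; rewrite !mxE.
under eq_bigr => j _ do rewrite mxE teval_sum.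
rewrite exchange_big; apply: eq_bigr => k _; rewrite mxevalE teval_sumr.
by apply: eq_bigr => j _; rewrite tevalM.
Qed.

Lemma mxevalD e d (M : 'M[Ktau]_(e, d)) x y :
  mxeval M (x + y) = mxeval M x + mxeval M y.
Proof.
apply/colP => i; rewrite !mxE -big_split.
by apply: eq_bigr => j _; rewrite mxE tevalDr.
Qed.

Lemma mxeval0 e d (M : 'M[Ktau]_(e, d)) : mxeval M 0 = 0.
Proof. by apply/colP => i; rewrite !mxE big1 // => j _; rewrite mxE teval0r. Qed.

Lemma mxevalB e d (M : 'M[Ktau]_(e, d)) x y :
  mxeval M (x - y) = mxeval M x - mxeval M y.
Proof.
by apply/eqP; rewrite eq_sym subr_eq -mxevalD subrK.
Qed.

Lemma mxeval_inj e d (M : 'M[Ktau]_(e, d)) :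
  (forall x, mxeval M x = 0 -> x = 0) -> injective (mxeval M).
Proof.
move=> M0 x y e_xy; apply/eqP; rewrite -subr_eq0; apply/eqP/M0.
by rewrite mxevalB e_xy subrr.
Qed.

End TwistedPolynomials.

(** * Scalar extension of twisted polynomials and their matrices *)

Section BaseChange.
Variables (F : finFieldType) (K L : fieldType).
Variables (gamma : {rmorphism {poly F} -> K}) (gammaL : {rmorphism {poly F} -> L}).
Variable (j : {rmorphism K -> L}).

Definition tmap (p : tpoly gamma) : tpoly gammaL := map_poly j (p : {poly K}).

Lemma tcoef_map p i : tcoef (tmap p) i = j (tcoef p i).
Proof. exact: coef_map. Qed.

Lemma tsize_map p : size (tmap p : {poly L}) = size (p : {poly K}).
Proof. exact: size_map_poly. Qed.

Lemma tmapD p r : tmap (p + r) = tmap p + tmap r.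
Proof. by apply: tpoly_ext => k; rewrite tcoefD !tcoef_map tcoefD rmorphD. Qed.

Lemma tmap0 : tmap 0 = 0.
Proof. by apply: tpoly_ext => k; rewrite tcoef_map !tcoef0 (rmorph0 j). Qed.

Lemma tmap_sum (I : Type) (s : seq I) (P : pred I) (f : I -> tpoly gamma) :
  tmap (\sum_(i <- s | P i) f i) = \sum_(i <- s | P i) tmap (f i).
Proof. exact: (big_morph _ tmapD tmap0). Qed.

Lemma tmapM p r : tmap (p * r) = tmap p * tmap r.
Proof.
apply: tpoly_ext => k; rewrite tcoefM tcoef_map tcoefM rmorph_sum.
by apply: eq_bigr => i _; rewrite !tcoef_map rmorphM rmorphXn.
Qed.

Lemma tmap_const c : tmap (tconst gamma c) = tconst gammaL (j c).
Proof.
apply: tpoly_ext => k; rewrite tcoef_map !tcoef_tconst.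
by case: ifP => // _; rewrite rmorph0.
Qed.

Lemma tmap1 : tmap 1 = 1.
Proof. by rewrite -tconst1 tmap_const rmorph1. Qed.

Lemma tmap_tau : tmap (tau gamma) = tau gammaL.
Proof. by apply: tpoly_ext => k; rewrite tcoef_map !tcoefX rmorph_nat. Qed.

Lemma base_changeE e d (M : 'M[tpoly gamma]_(e, d)) i k :
  base_change gammaL j M i k = tmap (M i k).
Proof. by rewrite mxE. Qed.

Lemma base_changeM e d c (M : 'M[tpoly gamma]_(e, d)) (N : 'M[tpoly gamma]_(d, c)) :
  base_change gammaL j (M *m N) = base_change gammaL j M *m base_change gammaL j N.
Proof.
apply/matrixP => i k; rewrite base_changeE !mxE tmap_sum.
by apply: eq_bigr => l _; rewrite tmapM !base_changeE.
Qed.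

End BaseChange.

Lemma base_change_id (F : finFieldType) (K : fieldType)
    (gamma : {rmorphism {poly F} -> K}) e d (M : 'M[tpoly gamma]_(e, d)) :
  base_change gamma idfun M = M.
Proof.
apply/matrixP => i k; rewrite base_changeE.
by apply: tpoly_ext => l; rewrite tcoef_map.
Qed.

(* Over the field of rational functions, evaluation at the variable X recovers
   all the coefficients, because the powers X^(q^i) are linearly independent. *)
Lemma mxeval_faithful (F : finFieldType) (K : fieldType)
    (gamma : {rmorphism {poly F} -> K}) e d (M N : 'M[tpoly gamma]_(e, d)) :
  (forall (L : fieldType) (gammaL : {rmorphism {poly F} -> L})
     (j : {rmorphism K -> L}), Afield_ext gamma gammaL j ->
   forall x, mxeval (base_change gammaL j M) x = mxeval (base_change gammaL j N) x) ->
  M = N.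
Proof.
pose L := {fraction {poly K}}.
pose j : {rmorphism K -> L} := (@tofrac {poly K} \o polyC)%FUN.
pose gammaL : {rmorphism {poly F} -> L} := (j \o gamma)%FUN.
move=> /(_ L gammaL j (fun _ => erefl)) eMN.
have gt1q := finNzRing_gt1 F.
pose X : L := tofrac ('X : {poly K}).
(* [P p] is the ordinary polynomial with the same values as [p]. As [#|F| > 1], the exponents
   [#|F| ^ i] are distinct, so [P p] determines [p]. *)
pose P (p : tpoly gamma) : {poly K} :=
  \sum_(i < size (p : {poly K})) tcoef p i *: 'X^(#|F| ^ i).
have evX p : teval (tmap gammaL j p) X = tofrac (P p).
  rewrite /teval tsize_map rmorph_sum; apply: eq_bigr => i _.
  by rewrite tcoef_map /= -mul_polyC rmorphM rmorphXn.
have coefP p i : (P p)`_(#|F| ^ i) = tcoef p i.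
  rewrite coef_sum.
  under eq_bigr => k _ do rewrite coefZ coefXn eqn_exp2l //.
  have [ltk | lek] := ltnP i (size (p : {poly K})); last first.
    rewrite tcoef_default // big1 // => k _; case: eqP => [ek|]; last by rewrite mulr0.
    by move: (ltn_ord k); rewrite -ek ltnNge lek.
  rewrite (bigD1 (Ordinal ltk)) //= eqxx mulr1 big1 ?addr0 // => k neq.
  by case: eqP => [ek|]; [case/eqP: neq; apply: val_inj | rewrite mulr0].
apply/matrixP => i k; apply: tpoly_ext => l.
rewrite -!coefP (_ : P (M i k) = P (N i k)) //.
apply/eqP; rewrite -tofrac_eq -!evX; apply/eqP.
(* The vector with [X] in position [k] and 0 elsewhere isolates the entry [(i, k)]. *)
have := congr1 (fun A : 'cV_e => A i 0) (eMN (\col_c (if c == k then X else 0))).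
have one R : mxeval (base_change gammaL j R) (\col_c (if c == k then X else 0)) i 0
    = teval (tmap gammaL j (R i k)) X.
  rewrite mxevalE (bigD1 k) //= base_changeE mxE eqxx big1 ?addr0 // => c nck.
  by rewrite [X in teval _ X]mxE (negbTE nck) teval0r.
by rewrite !one.
Qed.

(** * Inner biderivations *)

Section Reduction.
Variables (F : finFieldType) (K : fieldType) (gamma : {rmorphism {poly F} -> K}).
Local Notation q := #|F|.
Local Notation Ktau := (tpoly gamma).
Local Notation tsize p := (size (p : {poly K})).

(** The form in which the hypotheses enter the reduction: it is stable under scalar extension and
    covers both the blocks Upsilon_l and the 1 by 1 matrices of the psi_k. *)
Definition good_triangular n (T : 'M[Ktau]_n) : Prop :=
  [/\ forall a b : 'I_n, (a < b)%N -> T a b = 0,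
      forall a, (1 < trank (T a a))%N & no_nilpotence T].

Definition tdegree_lt n (r : 'I_n -> nat) (D : 'rV[Ktau]_n) : Prop :=
  forall b k, (r b <= k)%N -> tcoef (D 0 b) k = 0.

Lemma tcoef_trank (p : Ktau) k : (trank p < k)%N -> tcoef p k = 0.
Proof. by move=> lt_k; rewrite tcoef_default // (leq_trans (leqSpred _)). Qed.

Lemma tcoef_trank_neq0 (p : Ktau) : (0 < trank p)%N -> tcoef p (trank p) != 0.
Proof.
move=> p_gt0; rewrite -[tcoef p _]/(lead_coef (p : {poly K})) lead_coef_eq0.
by apply: contraTneq p_gt0 => p0; rewrite /trank p0 size_poly0.
Qed.

(** For [i < s] the index [s + t - i] exceeds [t], and for [i > s] the left factor has no term, so a
    single product survives. *)
Lemma tcoefM_top (p r : Ktau) s t :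
  (forall i, (s < i)%N -> tcoef p i = 0) -> (forall i, (t < i)%N -> tcoef r i = 0) ->
  tcoef (p * r) (s + t) = tcoef p s * tcoef r t ^+ (q ^ s).
Proof.
move=> p0 r0; rewrite tcoefM.
have lt_s : (s < (s + t).+1)%N by rewrite ltnS leq_addr.
rewrite (bigD1 (Ordinal lt_s)) //= addKn big1 ?addr0 // => i neq.
have [lt_si | lt_is | e] := ltngtP i s; last by case/eqP: neq; apply: val_inj.
  by rewrite r0 ?expr0_card ?mulr0 // ltn_subRL ltn_add2r.
by rewrite p0 ?mul0r.
Qed.

Lemma carlitzM n (U : 'rV[Ktau]_n) :
  carlitz gamma *m U = (tconst gamma (theta gamma) + tau gamma) *: U.
Proof. exact: mul_scalar_mx. Qed.

Lemma tcoef_carlitzM (p : Ktau) k :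
  tcoef ((tconst gamma (theta gamma) + tau gamma) * p) k
    = theta gamma * tcoef p k + (if k is k'.+1 then tcoef p k' ^+ q else 0).
Proof. by rewrite mulrDl tcoefD tcoef_constM tcoef_tauM. Qed.

(** This is the uniqueness of reduced representatives. If [D = U T - C_t U] and [b] is the last
    column with [U_b] nonzero, of degree [s], triangularity leaves [D_b = U_b T_bb - C_t U_b], whose
    coefficient in degree [s + rk] is nonzero. *)
Lemma der_in_reduced_eq0 n (T : 'M[Ktau]_n) (D : 'rV[Ktau]_n) :
  good_triangular T -> tdegree_lt (diag_rank T) D ->
  der_in T (carlitz gamma) D -> D = 0.
Proof.
move=> [Ttri Trk _] Dred [U eD].
suff U0 : U = 0 by rewrite eD U0 mul0mx mulmx0 subr0.
suff: forall m (b : 'I_n), (n - b <= m)%N -> U 0 b = 0.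
  by move=> U0; apply/rowP => b; rewrite mxE (U0 n) // leq_subr.
(* The induction runs over columns from the last to the first. *)
elim=> [|m IH] b; first by rewrite leqn0 subn_eq0 leqNgt ltn_ord.
move=> le_b; have Ugt (a : 'I_n) : (b < a)%N -> U 0 a = 0.
  move=> lt_ba; apply: IH; rewrite -ltnS; apply: leq_trans le_b.
  by rewrite ltn_sub2l.
have eDb : D 0 b = U 0 b * T b b - (tconst gamma (theta gamma) + tau gamma) * U 0 b.
  rewrite eD carlitzM !mxE (bigD1 b) //= big1 ?addr0 // => a neq.
  have [lt_ab | lt_ba | e] := ltngtP a b; first by rewrite Ttri ?mulr0.
    by rewrite Ugt ?mul0r.
  by case/eqP: neq; apply: val_inj.
apply: contraTeq isT => nzU; set p := U 0 b in eDb nzU.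
have sz_gt0 : (0 < tsize p)%N by rewrite lt0n size_poly_eq0.
pose s := (tsize p).-1.
have p0 i : (s < i)%N -> tcoef p i = 0.
  by rewrite /s prednK // => le_i; rewrite tcoef_default.
have lead_p : tcoef p s != 0.
  by rewrite -[tcoef p s]/(lead_coef (p : {poly K})) lead_coef_eq0.
have := Dred b (s + diag_rank T b)%N (leq_addl _ _).
rewrite eDb tcoefB (tcoefM_top p0 (@tcoef_trank (T b b))) tcoef_carlitzM.
(* Rank at least 2 puts degree [s + rk] above the degree [s + 1] of [C_t U_b], so only the product
   of leading terms remains. *)
have := Trk b; rewrite /diag_rank; case er: (trank (T b b)) => [|[|r]] // _.
rewrite !addnS [tcoef p _.+2]p0 ?ltnS ?leqW ?leq_addr //.
rewrite [tcoef p _.+1]p0 ?ltnS ?leq_addr //.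
rewrite mulr0 -[X in 0 ^+ X]expn1 expr0_card addr0 subr0 => /eqP.
rewrite mulf_eq0 (negbTE lead_p) expf_eq0 /= -er.
by rewrite (negbTE (tcoef_trank_neq0 _)) ?er // andbF.
Qed.

Lemma der_inB n (T : 'M[Ktau]_n) (D D' : 'rV[Ktau]_n) :
  der_in T (carlitz gamma) D -> der_in T (carlitz gamma) D' ->
  der_in T (carlitz gamma) (D - D').
Proof.
move=> [U ->] [U' ->]; exists (U - U').
by rewrite mulmxBl mulmxBr !opprD !opprK !addrA (addrAC (U *m T)).
Qed.

Lemma der_inN n (T : 'M[Ktau]_n) (D : 'rV[Ktau]_n) :
  der_in T (carlitz gamma) D -> der_in T (carlitz gamma) (- D).
Proof. by move=> [U ->]; exists (- U); rewrite mulNmx mulmxN opprB opprK addrC. Qed.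

Lemma der_in_0 n (T : 'M[Ktau]_n) : der_in T (carlitz gamma) (0 : 'rV_n).
Proof. by exists 0; rewrite mul0mx mulmx0 subr0. Qed.

Lemma der_inD n (T : 'M[Ktau]_n) (D D' : 'rV[Ktau]_n) :
  der_in T (carlitz gamma) D -> der_in T (carlitz gamma) D' ->
  der_in T (carlitz gamma) (D + D').
Proof. by move=> iD /der_inN iD'; rewrite -[D']opprK; apply: der_inB. Qed.

Lemma der_in_sum n (T : 'M[Ktau]_n) m (D : 'I_m -> 'rV[Ktau]_n) :
  (forall i, der_in T (carlitz gamma) (D i)) ->
  der_in T (carlitz gamma) (\sum_i D i).
Proof.
by move=> iD; apply: (big_ind (der_in T (carlitz gamma)));
  [apply: der_in_0 | apply: der_inD | move=> *; apply: iD].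
Qed.

Lemma der_in_trans n (T : 'M[Ktau]_n) (D' D D'' : 'rV[Ktau]_n) :
  der_in T (carlitz gamma) (D - D') -> der_in T (carlitz gamma) (D' - D'') ->
  der_in T (carlitz gamma) (D - D'').
Proof. by move=> i1 i2; rewrite -(subrKA D'); apply: der_inD. Qed.

Lemma der_in_sym n (T : 'M[Ktau]_n) (D D' : 'rV[Ktau]_n) :
  der_in T (carlitz gamma) (D - D') -> der_in T (carlitz gamma) (D' - D).
Proof. by move=> /der_inN; rewrite opprB. Qed.

Lemma der_in_carlitz n (T : 'M[Ktau]_n) (D : 'rV[Ktau]_n) :
  der_in T (carlitz gamma) D -> der_in T (carlitz gamma) (carlitz gamma *m D).
Proof.
by move=> [U ->]; exists (carlitz gamma *m U); rewrite mulmxBr !mulmxA.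
Qed.

Lemma der_in_comp n n' (T : 'M[Ktau]_n) (T' : 'M[Ktau]_n') f (D : 'rV[Ktau]_n') :
  is_morphism T T' f -> der_in T' (carlitz gamma) D ->
  der_in T (carlitz gamma) (D *m f).
Proof.
by move=> fT [U ->]; exists (U *m f); rewrite mulmxBl -!mulmxA fT.
Qed.

(** The constant part of [T] is the scalar theta, so [U T] and [C_t U] both have theta times the
    constant term of [U]. Hence Der_in and Der_in,0 coincide. *)
Lemma der_in_der0 n (T : 'M[Ktau]_n) (D : 'rV[Ktau]_n) :
  no_nilpotence T -> der_in T (carlitz gamma) D -> der0 D.
Proof.
move=> T0 [U ->]; apply/rowP => b; rewrite carlitzM !mxE tcoefB.
rewrite tcoef_carlitzM addr0 tcoef_sum (bigD1 b) //= big1 => [|a neq].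
  rewrite tcoefM big_ord1 subnn expr1.
  have := congr1 (fun M : 'M_n => M b b) T0; rewrite !mxE eqxx => ->.
  by rewrite mulr1n mulrC addr0 subrr.
rewrite tcoefM big_ord1 subnn expr1.
have := congr1 (fun M : 'M_n => M a b) T0; rewrite !mxE (negbTE neq) => ->.
by rewrite mulr0.
Qed.

End Reduction.

(** * Reduction of biderivations depending on a parameter *)

Section FormalReduction.
Variables (F : finFieldType) (K : fieldType) (gamma : {rmorphism {poly F} -> K}).
Local Notation q := #|F|.
Local Notation Ktau := (tpoly gamma).
Local Notation fam n := 'rV[{poly Ktau}]_n.

(* An element Delta of [fam n] is a family of biderivations depending on one
   parameter y: the operator (Delta 0 b)`_k applied to y is the coefficient of
   tau^k in column b. *)

Lemma coef_famB n (D D' : fam n) b k :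
  ((D - D') 0 b)`_k = (D 0 b)`_k - (D' 0 b)`_k.
Proof. by rewrite mxE coefD mxE coefN. Qed.

(** This is the family [u(y) tau^s] times row [a] of [f], with the powers of [tau] moved to the
    right of the coefficients of [f]. *)
Definition fmono n n' (u : Ktau) s (f : 'M[Ktau]_(n', n)) (a : 'I_n') : fam n :=
  \row_b \poly_(k < size (f a b : {poly K}) + s)
    (if (s <= k)%N then tconst gamma (tcoef (f a b) (k - s) ^+ (q ^ s)) * u else 0).

Lemma coef_fmono n n' u s (f : 'M[Ktau]_(n', n)) a b k :
  (fmono u s f a 0 b)`_k
    = if (s <= k)%N then tconst gamma (tcoef (f a b) (k - s) ^+ (q ^ s)) * u else 0.
Proof.
rewrite mxE coef_poly; case: ltnP => // le_k; case: ifP => // le_sk.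
by rewrite tcoef_default ?expr0_card ?tconst0 ?mul0r // leq_subRL // addnC.
Qed.

Section Evaluation.
Variables (L : fieldType) (gammaL : {rmorphism {poly F} -> L}).
Variable (j : {rmorphism K -> L}).

Definition fev n (y : L) (D : fam n) : 'rV[tpoly gammaL]_n :=
  \row_b (\poly_(k < size (D 0 b)) teval (tmap gammaL j (D 0 b)`_k) y : {poly L}).

Lemma tcoef_fev n y (D : fam n) b k :
  tcoef (fev y D 0 b) k = teval (tmap gammaL j (D 0 b)`_k) y.
Proof.
rewrite mxE /tcoef coef_poly; case: ltnP => // le_k.
by rewrite nth_default // tmap0 teval0.
Qed.

Lemma fevD n y (D D' : fam n) : fev y (D + D') = fev y D + fev y D'.
Proof.
apply/rowP => b; apply: tpoly_ext => k.
by rewrite [in RHS]mxE tcoefD !tcoef_fev mxE coefD tmapD tevalD.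
Qed.

Lemma fevB n y (D D' : fam n) : fev y (D - D') = fev y D - fev y D'.
Proof. by apply/eqP; rewrite eq_sym subr_eq -fevD subrK. Qed.

Lemma fev_fmono n n' y u s (f : 'M[Ktau]_(n', n)) a :
  fev y (fmono u s f a)
    = (tconst gammaL (teval (tmap gammaL j u) y) * tau gammaL ^+ s)
        *: row a (base_change gammaL j f).
Proof.
apply/rowP => b; apply: tpoly_ext => k.
rewrite tcoef_fev coef_fmono [in RHS]mxE tcoef_monoM mxE base_changeE tcoef_map.
case: ifP => _; last by rewrite tmap0 teval0.
by rewrite tmapM tmap_const teval_constM rmorphXn mulrC.
Qed.

Lemma base_change1 n : base_change gammaL j (1%:M : 'M[Ktau]_n) = 1%:M.
Proof.
apply/matrixP => a b; rewrite base_changeE !mxE.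
by case: eqP => _; rewrite ?tmap1 ?tmap0.
Qed.

End Evaluation.

(** This is the family [C_t u(y) tau^s e_b]: since [tau u(y) = u(y)^q tau], the coefficient in
    degree [s + 1] is the operator [tau * u]. *)
Definition cmono n (u : Ktau) s (b : 'I_n) : fam n :=
  fmono (tconst gamma (theta gamma) * u) s 1%:M b + fmono (tau gamma * u) s.+1 1%:M b.

Lemma coef_cmono n u s (a b : 'I_n) k :
  (cmono u s a 0 b)`_k
    = if a == b then
        if k == s then tconst gamma (theta gamma) * u
        else if k == s.+1 then tau gamma * u else 0
      else 0.
Proof.
have e1 i t : tconst gamma (tcoef ((1%:M : 'M[Ktau]_n) a b) i ^+ (q ^ t))
    = (if (a == b) && (i == 0%N) then 1 else 0).
  rewrite mxE; case: eqP => _ /=.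
    by rewrite tcoef1; case: eqP => _; rewrite ?expr1n ?expr0_card ?tconst0 ?tconst1.
  by rewrite tcoef0 expr0_card tconst0.
rewrite mxE coefD !coef_fmono !e1 !subn_eq0.
case: eqP => /= _; last by rewrite !mul0r !if_same addr0.
case: (ltngtP k s) => [lt_ks | lt_sk | e_ks].
- by rewrite (ltn_eqF (leqW lt_ks)) addr0.
- rewrite mul0r add0r; case: (ltngtP k s.+1) => [||_]; rewrite ?mul0r ?mul1r //.
  by rewrite ltnS leqNgt lt_sk.
- by rewrite mul1r addr0.
Qed.

Lemma fev_cmono (L : fieldType) (gammaL : {rmorphism {poly F} -> L})
    (j : {rmorphism K -> L}) n y u s (b : 'I_n) :
  Afield_ext gamma gammaL j ->
  fev gammaL j y (cmono u s b)
    = carlitz gammaL *m ((tconst gammaL (teval (tmap gammaL j u) y) * tau gammaL ^+ s)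
        *: delta_mx 0 b).
Proof.
move=> eL; rewrite fevD !fev_fmono !base_change1 row1 carlitzM scalerA -scalerDl.
congr (_ *: _); rewrite mulrDl !tmapM tmap_const tmap_tau teval_constM teval_tauM.
rewrite /theta eL tconstM -mulrA; congr (_ + _).
by rewrite mulrA tau_comm exprS mulrA.
Qed.

(** Besides congruence modulo inner biderivations, two invariants are tracked. The constant term in
    tau keeps Der_0 stable under reduction. The linear part in [y], that is the coefficient of
    [tau^0] of each operator, yields the constant part of the t-action; its preservation is claimed
    only when the coefficients in degrees at least the rank have none. *)
Definition fequiv n (T : 'M[Ktau]_n) (D R : fam n) : Prop :=
  [/\ forall (L : fieldType) (gammaL : {rmorphism {poly F} -> L})
        (j : {rmorphism K -> L}), Afield_ext gamma gammaL j -> forall y,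
        der_in (base_change gammaL j T) (carlitz gammaL)
          (fev gammaL j y D - fev gammaL j y R),
      forall b, (D 0 b)`_0 = (R 0 b)`_0
    & (forall b k, (diag_rank T b <= k)%N -> tcoef (D 0 b)`_k 0 = 0) ->
      forall b k, tcoef (D 0 b)`_k 0 = tcoef (R 0 b)`_k 0].

Definition freduced n (T : 'M[Ktau]_n) (R : fam n) : Prop :=
  forall b k, (diag_rank T b <= k)%N -> (R 0 b)`_k = 0.

Lemma fequiv_refl n (T : 'M[Ktau]_n) D : fequiv T D D.
Proof. by split=> // L gammaL j _ y; rewrite subrr; apply: der_in_0. Qed.

Lemma fequiv_trans n (T : 'M[Ktau]_n) D' D D'' :
  fequiv T D D' -> fequiv T D' D'' -> fequiv T D D''.
Proof.
move=> [i1 c1 h1] [i2 c2 h2]; split.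
- by move=> L gammaL j eL y; apply: der_in_trans (i1 _ _ _ eL y) (i2 _ _ _ eL y).
- by move=> b; rewrite c1.
- move=> hD b k; rewrite h1 // h2 // => b' k' le_k.
  by rewrite -h1 // hD.
Qed.

(** The subtracted family is inner, given by [U = u(y) tau^s e_a]. For [s = 0] its constant terms
    cancel because [T] has no nilpotence; if [u] has no linear part, neither does the correction. *)
Lemma fequiv_mono n (T : 'M[Ktau]_n) (D : fam n) u s (a : 'I_n) :
  good_triangular T ->
  ((forall b k, (diag_rank T b <= k)%N -> tcoef (D 0 b)`_k 0 = 0) -> tcoef u 0 = 0) ->
  fequiv T D (D - (fmono u s T a - cmono u s a)).
Proof.
move=> [Ttri Trk T0] hu; split.
- move=> L gammaL j eL y; rewrite fevB subKr fevB fev_fmono (fev_cmono _ _ _ _ eL).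
  set c := _ * _; exists (c *: delta_mx 0 a).
  by rewrite -scalemxAl -rowE.
- move=> b; rewrite !coef_famB.
  rewrite coef_fmono coef_cmono; case: s => [|s]; last by rewrite if_same subrr subr0.
  rewrite leqnn subnn expr1.
  have := congr1 (fun M : 'M_n => M a b) T0; rewrite !mxE => ->.
  by case: eqP => _; rewrite ?mulr1n ?mulr0n ?tconst0 ?mul0r subrr subr0.
- move=> /hu u0 b k; rewrite !coef_famB.
  rewrite coef_fmono coef_cmono !tcoefB.
  rewrite !(fun_if (fun p : Ktau => tcoef p 0)) !tcoef_constM tcoef_tauM u0 !tcoef0.
  rewrite !mulr0 !if_same.
  by rewrite subrr subr0.
Qed.

(** Here [s] bounds the excess of degree in column [a], and each round removes the top coefficient.
    Row [a] of [T] vanishes right of the diagonal, so columns already reduced stay reduced. *)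
Lemma reduce_column n (T : 'M[Ktau]_n) (a : 'I_n) s (D : fam n) :
  good_triangular T ->
  (forall k, (diag_rank T a + s <= k)%N -> (D 0 a)`_k = 0) ->
  (forall (b : 'I_n) k, (a < b)%N -> (diag_rank T b <= k)%N -> (D 0 b)`_k = 0) ->
  {R | fequiv T D R
     & forall (b : 'I_n) k, (a <= b)%N -> (diag_rank T b <= k)%N -> (R 0 b)`_k = 0}.
Proof.
move=> Tgood; have [Ttri Trk _] := Tgood.
elim: s D => [|s IH] D Da Dgt.
  exists D => [|b k]; first exact: fequiv_refl.
  rewrite leq_eqVlt => /orP[/eqP/val_inj <- | ]; last exact: Dgt.
  by move=> le_k; apply: Da; rewrite addn0.
pose r := diag_rank T a; pose c := tcoef (T a a) r.
have c0 : c != 0 by apply: tcoef_trank_neq0; apply: ltnW.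
(* The top coefficient of [u(y) tau^s (c tau^r)] is [c^(q^s) u(y)], hence the division by
   [c^(q^s)]. *)
pose u := tconst gamma (c ^- (q ^ s)) * (D 0 a)`_(r + s).
have [||R eqR Rred] := IH (D - (fmono u s T a - cmono u s a)).
- move=> k le_k; rewrite !coef_famB coef_fmono coef_cmono.
  (* As the rank is at least 2, the Carlitz part of the correction, of degree at most [s + 1], does
     not reach degree [r + s]. *)
  have lt_sk : (s.+1 < k)%N.
    apply: leq_trans le_k; rewrite -[s.+2]/(2 + s)%N leq_add2r; exact: Trk.
  rewrite eqxx (gtn_eqF lt_sk) (gtn_eqF (ltnW lt_sk)) subr0 ltnW 1?ltnW //.
  move: le_k; rewrite leq_eqVlt => /orP[/eqP <- | lt_k].
    rewrite addnK /u mulrA -tconstM -/r -/c divff ?expf_neq0 //.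
    by rewrite tconst1 mul1r subrr.
  rewrite Da ?addnS // tcoef_trank ?expr0_card ?tconst0 ?mul0r ?subrr //.
  by rewrite ltn_subRL addnC.
- move=> b k lt_ab le_k; rewrite !coef_famB.
  rewrite coef_fmono coef_cmono Dgt // Ttri // tcoef0 expr0_card tconst0 mul0r if_same.
  by rewrite -val_eqE /= (ltn_eqF lt_ab) subrr subr0.
- exists R => //; apply: fequiv_trans eqR; apply: fequiv_mono => // hD.
  by rewrite tcoef_constM hD ?mulr0 // leq_addr.
Qed.

(** Columns are treated from the last to the first. The result is returned as data, so that one
    reduced family can be picked per coordinate when matrices are assembled. *)
Lemma reduce n (T : 'M[Ktau]_n) (D : fam n) :
  good_triangular T -> {R | fequiv T D R & freduced T R}.
Proof.
move=> Tgood.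
have: forall m, {R | fequiv T D R
  & forall (b : 'I_n) k, (n - m <= b)%N -> (diag_rank T b <= k)%N -> (R 0 b)`_k = 0}.
  elim=> [|m [R eqR Rred]].
    exists D => [|b k]; first exact: fequiv_refl.
    by rewrite subn0 leqNgt ltn_ord.
  have [le_nm | lt_mn] := leqP n m.
    exists R => // b k _; apply: Rred; move: le_nm; rewrite -subn_eq0 => /eqP ->.
    exact: leq0n.
  have lt_a : (n - m.+1 < n)%N by rewrite ltn_subrL (leq_ltn_trans _ lt_mn).
  pose a := Ordinal lt_a.
  have [||R' eqR' R'red] := @reduce_column n T a (size (R 0 a)) R Tgood.
  - by move=> k le_k; rewrite nth_default // (leq_trans _ le_k) // leq_addl.
  - by move=> b k; rewrite /= subnSK //; apply: Rred.
  by exists R' => //; apply: fequiv_trans eqR'.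
by move=> /(_ n)[R eqR Rred]; exists R => // b k; apply: Rred; rewrite subnn.
Qed.

End FormalReduction.

(** * Reduced coordinates *)

Section Coordinates.
Variables (F : finFieldType) (K : fieldType) (gamma : {rmorphism {poly F} -> K}).
Local Notation q := #|F|.
Local Notation Ktau := (tpoly gamma).
Variables (n : nat) (e : nat) (r : 'I_n -> nat).

(* [ext_coord] is the case e = 0 of this map, and [dual_coord] the case e = 1 with
   (r a).-1 for r a. *)
Definition shift_coord (x : 'cV[K]_(\sum_(a < n) r a)) : 'rV[Ktau]_n :=
  \row_a (\sum_(i < r a) submxcol x a i 0 *: 'X^(e + i) : {poly K}).

Lemma tcoef_shift_coord x b k :
  tcoef (shift_coord x 0 b) k
    = \sum_(i < r b) x (tagnat.Rank b i) 0 * (k == e + i)%N%:R.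
Proof.
rewrite mxE [LHS]coef_sum; apply: eq_bigr => i _.
by rewrite coefZ coefXn !mxE.
Qed.

Lemma tcoef_shift_coordD x b (i : 'I_(r b)) :
  tcoef (shift_coord x 0 b) (e + i) = x (tagnat.Rank b i) 0.
Proof.
rewrite tcoef_shift_coord (bigD1 i) //= eqxx mulr1 [X in _ + X]big1 ?addr0 // => k neq.
by rewrite eqn_add2l val_eqE eq_sym (negbTE neq) mulr0.
Qed.

Lemma tcoef_shift_coord_lt x b k : (k < e)%N -> tcoef (shift_coord x 0 b) k = 0.
Proof.
move=> lt_k; rewrite tcoef_shift_coord big1 // => i _.
by rewrite ltn_eqF ?mulr0 // (leq_trans lt_k) // leq_addr.
Qed.

Lemma tcoef_shift_coord_ge x b k :
  (e + r b <= k)%N -> tcoef (shift_coord x 0 b) k = 0.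
Proof.
move=> le_k; rewrite tcoef_shift_coord big1 // => i _.
by rewrite gtn_eqF ?mulr0 // (leq_trans _ le_k) // ltn_add2l.
Qed.

Lemma shift_coord_inj : injective shift_coord.
Proof.
move=> x y exy; apply/colP => k; rewrite -(tagnat.sig2K k).
by rewrite -!tcoef_shift_coordD exy.
Qed.

Lemma shift_coord_surj (D : 'rV[Ktau]_n) :
  (forall b k, (k < e)%N || (e + r b <= k)%N -> tcoef (D 0 b) k = 0) ->
  exists x, D = shift_coord x.
Proof.
move=> D0; pose c (k : 'I_(\sum_(a < n) r a)) :=
  tcoef (D 0 (tagnat.sig1 k)) (e + tagnat.sig2 k).
exists (\col_k c k); apply/rowP => b; apply: tpoly_ext => k.
have [lt_k | le_k] := ltnP k e; first by rewrite tcoef_shift_coord_lt ?D0 ?lt_k.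
have [le_rk | lt_rk] := leqP (e + r b) k.
  by rewrite tcoef_shift_coord_ge ?D0 ?le_rk ?orbT.
have lt_i : (k - e < r b)%N by rewrite ltn_subLR.
rewrite -(subnKC le_k) -[(k - e)%N]/(val (Ordinal lt_i)) tcoef_shift_coordD mxE.
by rewrite /c tagnat.Rank2K; congr (tcoef (D 0 _) _); rewrite tagnat.Rank1K.
Qed.

Lemma shift_coordB x y : shift_coord (x - y) = shift_coord x - shift_coord y.
Proof.
apply/rowP => b; apply: tpoly_ext => k.
rewrite [in RHS]mxE [X in tcoef (_ + X) _]mxE tcoefB.
rewrite !tcoef_shift_coord -sumrB; by apply: eq_bigr => i _; rewrite !mxE mulrBl.
Qed.

Lemma shift_coord0 : shift_coord 0 = 0.
Proof. by rewrite -[X in shift_coord X](subrr 0) shift_coordB subrr. Qed.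

Lemma shift_coord_sum x :
  shift_coord x = \sum_k (tconst gamma (x k 0) * tau gamma ^+ (e + tagnat.sig2 k))
                           *: delta_mx 0 (tagnat.sig1 k).
Proof.
apply/rowP => b; apply: tpoly_ext => l; rewrite tcoef_shift_coord summxE tcoef_sum.
(* [G] takes the block and the position as independent arguments, so that reindexing by
   [tagnat.rank] meets no dependent type. *)
pose G (k : 'I_(\sum_a r a)) a i := x k 0 * ((a == b) && (l == e + i)%N)%:R.
transitivity (\sum_k G k (tagnat.sig1 k) (tagnat.sig2 k)); last first.
  apply: eq_bigr => k _; rewrite mxE mxE eqxx /G /= (eq_sym b).
  case: eqP => _; last by rewrite !mulr0 tcoef0.
  by rewrite mulr1 tcoef_constM tcoef_tauX.
rewrite [RHS](reindex (@tagnat.rank _ r)) /=; last exact: (onW_bij _ tagnat.rank_bij).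
transitivity (\sum_a \sum_(i < r a) G (tagnat.Rank a i) a i).
  rewrite [RHS](bigD1 b) //= [X in _ = _ + X]big1 ?addr0 => [|a neq].
    by apply: eq_bigr => i _; rewrite /G eqxx.
  by rewrite big1 // => i _; rewrite /G (negbTE neq) mulr0.
rewrite (sig_big_dep _ _ (fun a (i : 'I_(r a)) => G (tagnat.Rank a i) a i)) /=.
apply: eq_bigr => -[a i] _ /=.
by rewrite -[tagnat.rank _]/(tagnat.Rank a i) tagnat.Rank2K /G /= tagnat.Rank1K.
Qed.

End Coordinates.
Arguments shift_coord {F K} gamma {n} e {r} x.

Section BaseChangeGood.
Variables (F : finFieldType) (K L : fieldType).
Variables (gamma : {rmorphism {poly F} -> K}) (gammaL : {rmorphism {poly F} -> L}).
Variables (j : {rmorphism K -> L}) (n : nat) (T : 'M[tpoly gamma]_n).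

Lemma diag_rank_base_change : diag_rank (base_change gammaL j T) =1 diag_rank T.
Proof. by move=> a; rewrite /diag_rank base_changeE /trank tsize_map. Qed.

Lemma good_base_change : Afield_ext gamma gammaL j ->
  good_triangular T -> good_triangular (base_change gammaL j T).
Proof.
move=> eL [Ttri Trk T0]; split.
- by move=> a b lt_ab; rewrite base_changeE Ttri ?tmap0.
- by move=> a; rewrite -[trank _]/(diag_rank _ a) diag_rank_base_change; apply: Trk.
- apply/matrixP => a b; have := congr1 (fun M : 'M_n => M a b) T0.
  rewrite !mxE tcoef_map => ->; rewrite /theta eL.
  by case: eqP => _; rewrite ?mulr1n // mulr0n rmorph0.
Qed.

End BaseChangeGood.

(** * The action of t and induced maps as matrices in reduced coordinates *)

Section Representation.
Variables (F : finFieldType) (K : fieldType) (gamma : {rmorphism {poly F} -> K}).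
Local Notation q := #|F|.
Local Notation Ktau := (tpoly gamma).
Local Notation fam n := 'rV[{poly Ktau}]_n.
Variables (n : nat) (e : nat) (r : 'I_n -> nat) (T : 'M[Ktau]_n).
Hypotheses (Tgood : good_triangular T) (le_e1 : (e <= 1)%N).
Hypothesis er : forall a, (e + r a)%N = diag_rank T a.

Lemma shift_coord_eq (L : fieldType) (gammaL : {rmorphism {poly F} -> L})
    (j : {rmorphism K -> L}) (x y : 'cV[L]_(\sum_a r a)) :
  Afield_ext gamma gammaL j ->
  der_in (base_change gammaL j T) (carlitz gammaL)
    (shift_coord gammaL e x - shift_coord gammaL e y) -> x = y.
Proof.
move=> eL /der_in_reduced_eq0 eq0; apply: (@shift_coord_inj _ _ gammaL n e r).
apply/eqP; rewrite -subr_eq0; apply/eqP/eq0; first exact: good_base_change.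
move=> b k; rewrite diag_rank_base_change -er => le_k.
by rewrite -shift_coordB tcoef_shift_coord_ge.
Qed.

Definition family_matrix m (R : 'I_m -> fam n) : 'M[Ktau]_(\sum_a r a, m) :=
  \matrix_(k, i) (R i 0 (tagnat.sig1 k))`_(e + tagnat.sig2 k).

Lemma family_matrixE m (R : 'I_m -> fam n) (L : fieldType)
    (gammaL : {rmorphism {poly F} -> L}) (j : {rmorphism K -> L}) x :
  (forall i, freduced T (R i)) ->
  (forall i b k, (k < e)%N -> (R i 0 b)`_k = 0) ->
  shift_coord gammaL e (mxeval (base_change gammaL j (family_matrix R)) x)
    = \sum_i fev gammaL j (x i 0) (R i).
Proof.
move=> Rred Rlow; apply/rowP => b; apply: tpoly_ext => k.
rewrite summxE tcoef_sum; under [RHS]eq_bigr => i _ do rewrite tcoef_fev.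
have [lt_k | le_k] := ltnP k e.
  rewrite tcoef_shift_coord_lt // [RHS]big1 // => i _.
  by rewrite Rlow // tmap0 teval0.
have [le_rk | lt_rk] := leqP (e + r b) k.
  rewrite tcoef_shift_coord_ge // [RHS]big1 // => i _.
  by rewrite Rred -?er // tmap0 teval0.
have lt_i : (k - e < r b)%N by rewrite ltn_subLR.
rewrite -(subnKC le_k) -[(k - e)%N]/(val (Ordinal lt_i)) tcoef_shift_coordD mxevalE.
apply: eq_bigr => i _; rewrite base_changeE mxE tagnat.Rank2K.
by congr (teval (tmap _ _ (R i 0 _)`_ _) _); rewrite tagnat.Rank1K.
Qed.

(** Reduction is given by twisted polynomials in the parameters, so an additive family of classes
    becomes a matrix over [K{tau}]. The second clause gives its constant part when the coefficients
    to be removed have no linear part. *)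
Lemma represent m (D : 'I_m -> fam n) :
  (forall i b k, (k < e)%N -> (D i 0 b)`_k = 0) ->
  {E : 'M[Ktau]_(\sum_a r a, m)
  | forall (L : fieldType) (gammaL : {rmorphism {poly F} -> L})
      (j : {rmorphism K -> L}), Afield_ext gamma gammaL j -> forall x : 'cV[L]_m,
      der_in (base_change gammaL j T) (carlitz gammaL)
        (\sum_i fev gammaL j (x i 0) (D i)
         - shift_coord gammaL e (mxeval (base_change gammaL j E) x))
  & (forall i b k, (diag_rank T b <= k)%N -> tcoef (D i 0 b)`_k 0 = 0) ->
    forall k i, tcoef (E k i) 0
      = tcoef (D i 0 (tagnat.sig1 k))`_(e + tagnat.sig2 k) 0}.
Proof.
move=> Dlow; pose R i := s2val (reduce (D i) Tgood).
have RD i : fequiv T (D i) (R i) by apply: s2valP.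
have Rred i : freduced T (R i) by apply: (s2valP' (reduce (D i) Tgood)).
have Rlow i b k : (k < e)%N -> (R i 0 b)`_k = 0.
  (* Since [e <= 1], only degree 0 can lie below [e], and reduction leaves the coefficient there
     unchanged. *)
  move=> lt_k; have k0 : k = 0%N by move: (leq_trans lt_k le_e1); case: (k).
  by have [_ c0 _] := RD i; rewrite k0 -c0 Dlow // -k0.
exists (family_matrix R).
  move=> L gammaL j eL x; rewrite family_matrixE // -sumrB.
  by apply: der_in_sum => i; have [] := RD i => + _ _; apply.
by move=> hD k i; rewrite mxE; have [_ _ /(_ (hD i)) ->] := RD i.
Qed.

(** On a monomial, [C_t] gives theta in the same degree and [tau] in the next one. Only the [tau]
    part can overflow the rank, and it has no linear part, so the constant part of the action stays
    scalar. *)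
Lemma represent_action :
  {E : 'M[Ktau]_(\sum_a r a)
  | forall (L : fieldType) (gammaL : {rmorphism {poly F} -> L})
      (j : {rmorphism K -> L}), Afield_ext gamma gammaL j -> forall x,
      der_in (base_change gammaL j T) (carlitz gammaL)
        (carlitz gammaL *m shift_coord gammaL e x
         - shift_coord gammaL e (mxeval (base_change gammaL j E) x))
  & mxconst E = (theta gamma)%:M}.
Proof.
pose D (k : 'I_(\sum_a r a)) : fam n := cmono 1 (e + tagnat.sig2 k) (tagnat.sig1 k).
have [i b k lt_k | E EP E0] := @represent _ D.
  rewrite coef_cmono (ltn_eqF (leq_trans lt_k (leq_addr _ _))).
  by rewrite (ltn_eqF (leqW (leq_trans lt_k (leq_addr _ _)))) if_same.
exists E => [L gammaL j eL x | ].
  suff -> : carlitz gammaL *m shift_coord gammaL e x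
      = \sum_k fev gammaL j (x k 0) (D k) by apply: EP.
  rewrite shift_coord_sum mulmx_sumr; apply: eq_bigr => k _.
  by rewrite fev_cmono // tmap1 teval1.
apply/matrixP => k i; rewrite !mxE E0 => [|{}i b l le_l].
  rewrite /D coef_cmono !mulr1 (fun_if (fun p : Ktau => tcoef p 0)).
  have [-> | nki] := eqVneq k i; first by rewrite !eqxx tcoef_tconst mulr1n.
  case: eqP => es1; last by rewrite tcoef0 mulr0n.
  case: eqP => [es2 | _]; last first.
    by case: ifP; rewrite ?tcoef0 ?mulr0n // [tcoef _ 0]tcoefX.
  case/eqP: nki; rewrite -[k]tagnat.sig2K -[i]tagnat.sig2K.
  apply/val_inj/eqP; rewrite /= tagnat.eq_Rank.
  by rewrite (introT eqP (esym es1)) (introT eqP (addnI es2)).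
(* In degrees at least the rank only the coefficient [tau] can occur, and it has no linear part. *)
rewrite coef_cmono !mulr1; case: eqP => // es1; rewrite ?tcoef0 //.
have lt_l : (e + tagnat.sig2 i < l)%N.
  apply: leq_trans le_l; rewrite -er ltn_add2l -es1; exact: ltn_ord.
rewrite gtn_eqF //; case: ifP; rewrite ?tcoef0 // => _.
by rewrite [tcoef _ 0]tcoefX.
Qed.

(** The case [e = e' = 1] serves maps between duals; [e = 0], [e' = 1] and [f = 1] give the
    inclusion of the dual in Ext. Multiplying by [f] on the right creates no term of degree below
    [e']. *)
Lemma represent_induced n' e' (r' : 'I_n' -> nat) (f : 'M[Ktau]_(n', n)) :
  (e <= e')%N ->
  {h : 'M[Ktau]_(\sum_a r a, \sum_a r' a)
  | forall (L : fieldType) (gammaL : {rmorphism {poly F} -> L})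
      (j : {rmorphism K -> L}), Afield_ext gamma gammaL j -> forall x,
      der_in (base_change gammaL j T) (carlitz gammaL)
        (shift_coord gammaL e' x *m base_change gammaL j f
         - shift_coord gammaL e (mxeval (base_change gammaL j h) x))}.
Proof.
move=> le_ee'.
pose D (k : 'I_(\sum_a r' a)) : fam n :=
  fmono 1 (e' + tagnat.sig2 k) f (tagnat.sig1 k).
have [i b k lt_k | h hP _] := @represent _ D.
  rewrite coef_fmono leqNgt (leq_trans lt_k) //.
  by rewrite (leq_trans le_ee') // leq_addr.
exists h => L gammaL j eL x.
suff -> : shift_coord gammaL e' x *m base_change gammaL j f
    = \sum_k fev gammaL j (x k 0) (D k) by apply: hP.
rewrite shift_coord_sum mulmx_suml; apply: eq_bigr => k _.
by rewrite -scalemxAl -rowE fev_fmono tmap1 teval1.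
Qed.

(** If [D] has coordinates [x], both composites give reduced representatives of the class of
    [C_t D f]. Uniqueness makes them equal at all points over all extensions, and [mxeval_faithful]
    lifts this to the matrices. *)
Lemma induced_morphism n' e' (r' : 'I_n' -> nat) (T' : 'M[Ktau]_n')
    (f : 'M[Ktau]_(n', n)) (E : 'M[Ktau]_(\sum_a r a)) (E' : 'M[Ktau]_(\sum_a r' a))
    (h : 'M[Ktau]_(\sum_a r a, \sum_a r' a)) :
  is_morphism T T' f ->
  (forall (L : fieldType) (gammaL : {rmorphism {poly F} -> L})
     (j : {rmorphism K -> L}), Afield_ext gamma gammaL j -> forall x,
     [/\ der_in (base_change gammaL j T) (carlitz gammaL)
           (carlitz gammaL *m shift_coord gammaL e x
            - shift_coord gammaL e (mxeval (base_change gammaL j E) x)),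
         forall x', der_in (base_change gammaL j T') (carlitz gammaL)
           (carlitz gammaL *m shift_coord gammaL e' x'
            - shift_coord gammaL e' (mxeval (base_change gammaL j E') x'))
       & forall x', der_in (base_change gammaL j T) (carlitz gammaL)
           (shift_coord gammaL e' x' *m base_change gammaL j f
            - shift_coord gammaL e (mxeval (base_change gammaL j h) x'))]) ->
  is_morphism E' E h.
Proof.
move=> fT H; apply: mxeval_faithful => L gammaL j eL x.
rewrite !base_changeM !mxevalM; apply: (shift_coord_eq eL).
have fTL : is_morphism (base_change gammaL j T) (base_change gammaL j T')
    (base_change gammaL j f).
  by rewrite /is_morphism -!base_changeM fT.
have [HE HE' Hh] := H L gammaL j eL (mxeval (base_change gammaL j h) x).
(* The chain of congruences is h E' x, (E' x) f, C_t x f, C_t h x, E h x; its last link is used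
   first. *)
apply: der_in_trans (HE).
apply: der_in_trans (der_in_sym (Hh _)) _.
have := der_in_comp fTL (HE' x); rewrite mulmxBl => /der_in_sym i1.
apply: der_in_trans i1 _; have := der_in_carlitz (Hh x).
by rewrite mulmxBr mulmxA.
Qed.

Lemma shift_coord_repr (L : fieldType) (gammaL : {rmorphism {poly F} -> L})
    (j : {rmorphism K -> L}) (D : 'rV[tpoly gammaL]_n) :
  Afield_ext gamma gammaL j ->
  (forall b k, (k < e)%N -> tcoef (D 0 b) k = 0) ->
  exists! x : 'cV[L]_(\sum_a r a),
    der_in (base_change gammaL j T) (carlitz gammaL) (D - shift_coord gammaL e x).
Proof.
move=> eL Dlow; set TL := base_change gammaL j T.
have TLgood : good_triangular TL by apply: good_base_change.
(* A single biderivation is the value at [y = 1] of a family with scalar coefficients, so the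
   parametric reduction over [L] applies to it. *)
pose D1 : 'rV[{poly tpoly gammaL}]_n :=
  \row_b \poly_(k < size (D 0 b : {poly L})) tconst gammaL (tcoef (D 0 b) k).
have D1c b k : (D1 0 b)`_k = tconst gammaL (tcoef (D 0 b) k).
  by rewrite mxE coef_poly; case: ltnP => // le_k; rewrite tcoef_default ?tconst0.
have [R [RD Rc0 _] Rred] := reduce D1 TLgood.
have := RD L gammaL idfun (fun _ => erefl) 1; rewrite base_change_id.
have -> : fev gammaL idfun 1 D1 = D.
  apply/rowP => b; apply: tpoly_ext => k.
  by rewrite tcoef_fev D1c tmap_const teval_const mulr1.
have [b k | x -> Dx] := @shift_coord_surj _ _ gammaL n e r (fev gammaL idfun 1 R).
  rewrite tcoef_fev; case/orP=> [lt_k | le_k].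
    have k0 : k = 0%N by move: (leq_trans lt_k le_e1); case: (k).
    by rewrite k0 -Rc0 D1c Dlow -?k0 // tconst0 tmap0 teval0.
  by rewrite Rred ?tmap0 ?teval0 // diag_rank_base_change -er.
exists x; split=> // y Dy; apply: (shift_coord_eq eL).
exact: der_in_trans (der_in_sym Dx) Dy.
Qed.

End Representation.

(** * Simplicity of the dual of a Drinfeld module *)

Section Simplicity.
Variables (F : finFieldType) (K : fieldType) (gamma : {rmorphism {poly F} -> K}).
Local Notation q := #|F|.
Local Notation Ktau := (tpoly gamma).
Local Notation tsize p := (size (p : {poly K})).

Lemma tpoly_top (p : Ktau) : p != 0 ->
  exists2 s, tcoef p s != 0 & forall i, (s < i)%N -> tcoef p i = 0.
Proof.
move=> p0; exists (tsize p).-1.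
  by rewrite -[tcoef p _]/(lead_coef (p : {poly K})) lead_coef_eq0.
move=> i lt_i; apply: tcoef_default; move: lt_i.
by rewrite prednK // lt0n size_poly_eq0.
Qed.

Lemma tmulf_neq0 (p r : Ktau) : p != 0 -> r != 0 -> p * r != 0.
Proof.
move=> /tpoly_top[s ps p0] /tpoly_top[t rt r0].
apply: contraTneq isT => pr0; have := tcoefM_top p0 r0.
rewrite pr0 tcoef0 => /esym/eqP; rewrite mulf_eq0 (negbTE ps) /=.
by rewrite expf_eq0 (negbTE rt) andbF.
Qed.

(** * Left linear dependence over [K{tau}] *)

Section LeftDependence.
Variables (a b N M : nat) (H : 'M[Ktau]_(a, b)).

Definition coef_row (A : 'M[K]_(a, N)) : 'rV[Ktau]_a :=
  \row_i (rVpoly (row i A) : {poly K}).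

Definition coef_mul (A : 'M[K]_(a, N)) : 'M[K]_(b, M) :=
  \matrix_(j, k) tcoef ((coef_row A *m H) 0 j) k.

Lemma tcoef_coef_row A i l :
  tcoef (coef_row A 0 i) l = if insub l is Some l' then A i l' else 0.
Proof.
by rewrite mxE [LHS]coef_rVpoly; case: insubP => [l' _ _|_] //; rewrite mxE.
Qed.

Fact coef_mul_is_linear : linear coef_mul.
Proof.
move=> c A A'; apply/matrixP => j k; rewrite !mxE !tcoef_sum mulr_sumr -big_split.
apply: eq_bigr => i _ /=; rewrite !tcoefM mulr_sumr -big_split.
apply: eq_bigr => l _ /=; rewrite !tcoef_coef_row.
by case: insubP => [l' _ _|_]; rewrite ?mul0r ?mulr0 ?addr0 // !mxE mulrDl mulrA.
Qed.

HB.instance Definition _ :=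
  GRing.isLinear.Build K 'M[K]_(a, N) 'M[K]_(b, M) _ coef_mul coef_mul_is_linear.

End LeftDependence.

(* Left multiplication by scalars makes v |-> v H a K-linear map; on rows of
   degree < N it has a kernel as soon as a N > b (N + h). *)
Lemma left_dependent a b (H : 'M[Ktau]_(a, b)) : (b < a)%N ->
  exists2 v : 'rV[Ktau]_a, v != 0 & v *m H = 0.
Proof.
move=> lt_ba; pose h := (\max_i \max_j tsize (H i j))%N.
have le_h i j : (tsize (H i j) <= h)%N.
  exact: leq_trans (leq_bigmax (F := fun j => tsize (H i j)) j)
                   (leq_bigmax (F := fun i => \max_j tsize (H i j))%N i).
(* This choice gives [b (N + h) < (b + 1) N <= a N], which forces a nonzero kernel. *)
pose N := (b * h).+1; pose M := (N + h)%N.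
have lt_M : (b * M < a * N)%N.
  apply: leq_trans (leq_mul lt_ba (leqnn N)).
  by rewrite mulSn /M mulnDr addnC ltn_add2r ltnS.
pose f := @coef_mul a b N M H.
have [u uB u0] : exists2 u : 'rV_(a * N), u *m lin_mx f = 0 & u != 0.
  have: kermx (lin_mx f) != 0.
    rewrite kermx_eq0 /row_free; apply: contraTneq lt_M => <-.
    by rewrite -leqNgt rank_leq_col.
  by case/rowV0Pn => u /sub_kermxP uB u0; exists u.
pose A := vec_mx u; have fA : f A = 0.
  by apply: (can_inj mxvecK); rewrite -mul_vec_lin vec_mxK uB linear0.
exists (coef_row A).
  apply: contraNneq u0 => v0; rewrite -[u]vec_mxK -/A.
  suff -> : A = 0 by rewrite linear0.
  apply/matrixP => i l; have := congr1 (fun v : 'rV[Ktau]_a => tcoef (v 0 i) l) v0.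
  by rewrite tcoef_coef_row valK !mxE tcoef0.
apply/rowP => j; apply: tpoly_ext => k; rewrite [in RHS]mxE tcoef0.
have [lt_k | le_k] := ltnP k M.
  by have := congr1 (fun B : 'M_(b, M) => B j (Ordinal lt_k)) fA; rewrite !mxE.
rewrite mxE tcoef_sum big1 // => i _; rewrite tcoefM big1 // => l _.
rewrite tcoef_coef_row; case: insubP => [l' lt_l _ | _]; last by rewrite mul0r.
rewrite [X in _ * X ^+ _]tcoef_default ?expr0_card ?mulr0 //.
apply: leq_trans (le_h i j) _; rewrite leq_subRL.
  by apply: leq_trans le_k; rewrite /M leq_add2r ltnW.
by apply: leq_trans le_k; rewrite ltnW // (leq_trans lt_l) // leq_addr.
Qed.


(** * Weights on the motive [K{tau}^d] *)

Section Weights.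
Variable d : nat.

(* The weight is a bijection from the monomials tau^k e_i onto the natural
   numbers. *)
Definition weight (i : 'I_d) (k : nat) : nat := k * d + (d - i.+1).

Definition has_top (m : 'rV[Ktau]_d) w : Prop := exists i k,
  [/\ weight i k = w, tcoef (m 0 i) k != 0
    & forall i' k', (w < weight i' k')%N -> tcoef (m 0 i') k' = 0].

Lemma has_top_neq0 m w : has_top m w -> m != 0.
Proof.
by case=> i [k [_ mik _]]; apply: contraNneq mik => ->; rewrite mxE tcoef0.
Qed.

Lemma has_top_exists m : m != 0 -> exists w, has_top m w.
Proof.
case/rV0Pn => i0 mi0; pose h := (\max_i tsize (m 0%R i))%N.
have le_h i : (tsize (m 0%R i) <= h)%N.
  by apply: (leq_bigmax (F := fun i => tsize (m 0 i))).
have [s0 ms0 _] := tpoly_top mi0.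
have lt_h i s : tcoef (m 0 i) s != 0 -> (s < h)%N.
  move=> ms; apply: leq_trans (le_h i); rewrite ltnNge.
  by apply: contra ms => /tcoef_default ->.
pose P (x : 'I_d * 'I_h) := tcoef (m 0 x.1) x.2 != 0.
have P0 : P (i0, Ordinal (lt_h _ _ ms0)) by [].
case: (arg_maxnP (fun x : 'I_d * 'I_h => weight x.1 x.2) P0) => -[i k] Pik maxik.
exists (weight i k), i, k; split=> // i' k' lt_w.
apply: contraTeq lt_w => mi'; rewrite -leqNgt.
exact: (maxik (i', Ordinal (lt_h _ _ mi'))).
Qed.

Lemma has_top_scale (p : Ktau) m w s :
  tcoef p s != 0 -> (forall i, (s < i)%N -> tcoef p i = 0) ->
  has_top m w -> has_top (p *: m) (w + s * d).
Proof.
move=> ps p0 [i [k [<- mik m0]]].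
have d_gt0 : (0 < d)%N := leq_ltn_trans (leq0n i) (ltn_ord i).
exists i, (s + k)%N; rewrite mxE; split; first by rewrite /weight; nia.
  rewrite (tcoefM_top p0) => [|l lt_kl]; last by apply: m0; rewrite /weight; nia.
  by rewrite mulf_neq0 // expf_neq0.
move=> i' k' lt_w; rewrite mxE tcoefM big1 // => l _.
have [le_ls | lt_sl] := leqP l s; last by rewrite p0 ?mul0r.
rewrite m0 ?expr0_card ?mulr0 //; have := ltn_ord l; move: lt_w; rewrite /weight; nia.
Qed.

(** The nonzero term of largest weight contains a monomial that no other term can cancel. *)
Lemma has_top_sum m (G : 'I_m -> 'rV[Ktau]_d) w :
  (forall a, G a = 0 \/ has_top (G a) (w a)) ->
  (forall a b, w a = w b -> a = b) -> (exists a, G a != 0) -> \sum_a G a != 0.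
Proof.
move=> Gtop w_inj [a0 Ga0].
case: (arg_maxnP (P := fun a => G a != 0) w Ga0) => a Ga maxa.
case: (Gtop a) => [Ga_0|[i [k [wik Gik _]]]]; first by rewrite Ga_0 eqxx in Ga.
apply: contraNneq Gik => sum0.
have := congr1 (fun M : 'rV[Ktau]_d => tcoef (M 0 i) k) sum0.
rewrite summxE tcoef_sum (bigD1 a) //= mxE tcoef0 big1 ?addr0 => [-> // | b nba].
have [-> | Gb] := eqVneq (G b) 0; first by rewrite mxE tcoef0.
case: (Gtop b) => [-> | [_ [_ [_ _ ->]]] //]; first by rewrite mxE tcoef0.
rewrite wik ltn_neqAle (maxa b Gb : (w b <= w a)%N) andbT.
by apply: contra nba => /eqP/w_inj ->.
Qed.

(* Right multiplication by S, that is the action of t on the motive of S, raises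
   the weight by exactly d + 1. *)
Definition raises_weight (S : 'M[Ktau]_d) : Prop :=
  (forall (i j : 'I_d) t, (j + d.+1 < t * d + i)%N -> tcoef (S i j) t = 0) /\
  (forall i : 'I_d, exists (j : 'I_d) t,
     (t * d + i = j + d.+1)%N /\ tcoef (S i j) t != 0).

Variable S : 'M[Ktau]_d.
Hypothesis S_raises : raises_weight S.

(** A term [tau^t] in the entry [(i, j)] shifts weights by [t d + i - j], which is at most [d + 1].
    Equality is attained on the top monomial, and no lower monomial reaches the same weight. *)
Lemma has_top_mul m w : has_top m w -> has_top (m *m S) (w + d.+1).
Proof.
have [S0 Stop] := S_raises; case=> i [k [<- mik m0]].
have [j [t [ejt Sijt]]] := Stop i.
have ltid := ltn_ord i; have ltjd := ltn_ord j.
have d_gt0 : (0 < d)%N by lia.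
exists j, (k + t)%N; split; first by rewrite /weight; nia.
  have lt_k : (k < (k + t).+1)%N by rewrite ltnS leq_addr.
  rewrite mxE tcoef_sum (bigD1 i) //= [X in _ + X]big1 ?addr0 => [|i' ni'].
    rewrite tcoefM (bigD1 (Ordinal lt_k)) //= addKn big1 ?addr0 => [|l nl].
      by rewrite mulf_neq0 // expf_neq0.
    have [lt_kl | lt_lk | e_kl] := ltngtP k l; last by case/eqP: nl; apply: val_inj.
      by rewrite m0 ?mul0r //; rewrite /weight; nia.
    rewrite S0 ?expr0_card ?mulr0 //; nia.
  (* In another component [i'] the weight of the top cannot occur, as weights modulo [d] determine
     the component; all monomials there have smaller weight. *)
  rewrite tcoefM big1 // => l _.
  have lti'd := ltn_ord i'; have nii' : i' <> i :> nat by move=> /val_inj/eqP; apply/negP.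
  have [lt_w | le_w] := ltnP (weight i k) (weight i' l); first by rewrite m0 ?mul0r.
  rewrite S0 ?expr0_card ?mulr0 //; move: le_w (ltn_ord l); rewrite /weight => le_w lt_l.
  have [lt_lk | le_kl] := ltnP l k; first by nia.
  have e_l : l = k :> nat by nia.
  rewrite e_l in le_w *; nia.
move=> j' k' lt_w; rewrite mxE tcoef_sum big1 // => i' _; rewrite tcoefM big1 // => l _.
have lti'd := ltn_ord i'; have ltj'd := ltn_ord j'.
have [lt_w' | le_w] := ltnP (weight i k) (weight i' l); first by rewrite m0 ?mul0r.
rewrite S0 ?expr0_card ?mulr0 //; move: lt_w le_w (ltn_ord l); rewrite /weight; nia.
Qed.


Definition iter_mul m (A : 'M[Ktau]_m) (v : 'rV[Ktau]_m) k : 'rV[Ktau]_m :=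
  iter k (fun u => u *m A) v.

Lemma has_top_iter m w k : has_top m w -> has_top (iter_mul S m k) (w + k * d.+1).
Proof.
move=> mw; elim: k => [|k IH]; first by rewrite mul0n addn0.
by rewrite /iter_mul iterS mulSn addnCA addnC; apply: has_top_mul.
Qed.

(** The nonzero terms have top weights [w + a (d + 1) + s_a d], congruent to [w + a] modulo [d] and
    hence distinct for [a < d]. *)
Lemma iter_mul_free m : m != 0 ->
  forall v : 'rV[Ktau]_d, v != 0 -> v *m (\matrix_a iter_mul S m a) != 0.
Proof.
move=> /has_top_exists[w mw] v v0; rewrite mulmx_sum_row.
pose s (a : 'I_d) := (tsize (v 0 a)).-1.
have vtop a : v 0 a != 0 ->
    has_top (v 0 a *: iter_mul S m a) (w + a * d.+1 + s a * d).
  move=> va; apply: has_top_scale; last exact: has_top_iter.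
    by rewrite -[tcoef _ _]/(lead_coef (v 0 a : {poly K})) lead_coef_eq0.
  by move=> i lt_i; apply: tcoef_trank.
apply: (@has_top_sum _ _ (fun a => w + a * d.+1 + s a * d)%N) => [a|a b e|].
- rewrite rowK; have [-> | va] := eqVneq (v 0 a) 0; [left | right].
    by rewrite scale0r.
  exact: vtop.
- have wE (c : 'I_d) : (w + c * d.+1 + s c * d = (c + s c) * d + (w + c))%N.
    by rewrite mulnS mulnDl; lia.
  apply: val_inj => /=; have := congr1 (fun x => x %% d)%N e; rewrite !wE !modnMDl.
  by move/eqP; rewrite eqn_modDl !modn_small // => /eqP.
case/rV0Pn: v0 => a va; exists a; rewrite rowK.
exact: has_top_neq0 (vtop a va).
Qed.

Section NonzeroMorphism.
Variables (d2 : nat) (T2 : 'M[Ktau]_d2) (g : 'M[Ktau]_(d2, d)).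
Hypotheses (gS : is_morphism S T2 g) (g0 : g != 0).

(** For a nonzero row [g_j] of [g], the rows [e_j T2^a] of [H] satisfy [e_j T2^a g = g_j S^a], and
    these are left independent. *)
Lemma morphism_rows : exists H : 'M[Ktau]_(d, d2),
  forall v : 'rV[Ktau]_d, v != 0 -> v *m (H *m g) != 0.
Proof.
have [j gj0] : exists j, row j g != 0.
  apply/existsP; apply: contraNT g0; rewrite negb_exists => /forallP r0.
  by apply/eqP/row_matrixP => i; rewrite row0; apply/eqP; rewrite -[_ == _]negbK.
exists (\matrix_a iter_mul T2 (delta_mx 0 j) a) => v v0.
suff -> : (\matrix_a iter_mul T2 (delta_mx 0 j) a) *m g
    = \matrix_(a < d) iter_mul S (row j g) a by apply: iter_mul_free.
apply/row_matrixP => a; rewrite row_mul !rowK.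
elim: (a : nat) => [|k IH]; first by rewrite -rowE.
by rewrite /iter_mul !iterS -mulmxA -gS mulmxA; congr (_ *m _).
Qed.

Lemma morphism_dim : (d <= d2)%N.
Proof.
have [H Hg] := morphism_rows; rewrite leqNgt; apply/negP => lt_d.
have [v v0 vH] := left_dependent H lt_d.
by have := Hg v v0; rewrite mulmxA vH mul0mx eqxx.
Qed.

(** Deleting column [i] of [H g] leaves [d] rows of length [d - 1], hence a relation that kills all
    other columns. The resulting [p] kills the coordinate [i] of every point in the kernel of
    [g]. *)
Lemma morphism_annihilator (i : 'I_d) :
  exists2 p : Ktau, p != 0 & exists w : 'rV[Ktau]_d2, w *m g = p *: delta_mx 0 i.
Proof.
have [H Hg] := morphism_rows.
have lt_d : (d.-1 < d)%N by rewrite prednK // (leq_ltn_trans _ (ltn_ord i)).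
have [v v0 vG] := left_dependent (col' i (H *m g)) lt_d.
have eqv : v *m (H *m g) = (v *m (H *m g)) 0 i *: delta_mx 0 i.
  move: (H *m g) vG => G vG.
  apply/rowP => b; rewrite [in RHS]mxE [X in _ * X]mxE eqxx /=.
  have [->|nbi] := eqVneq b i; first by rewrite mulr1.
  case: (unliftP i b) => [b' eb | eb]; last by rewrite eb eqxx in nbi.
  have := congr1 (fun M : 'rV_d.-1 => M 0 b') vG.
  rewrite mulr0 !mxE => vGb; rewrite -[RHS]vGb.
  by apply: eq_bigr => l _; rewrite mxE eb.
exists ((v *m (H *m g)) 0 i); last by exists (v *m H); rewrite -mulmxA.
apply: contraNneq (Hg v v0) => e0; by rewrite eqv e0 scale0r.
Qed.

End NonzeroMorphism.

End Weights.

(** The operator of [p] is a nonzero ordinary polynomial function, so its roots are bounded in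
    number by the degree. *)
Lemma teval_roots (p : Ktau) : p != 0 ->
  exists N, forall s : seq K,
    uniq s -> all (fun x => teval p x == 0) s -> (size s <= N)%N.
Proof.
move=> p0; have [k pk _] := tpoly_top p0.
have gt1q := finNzRing_gt1 F.
pose P : {poly K} := \sum_(i < tsize p) tcoef p i *: 'X^(q ^ i).
have Px x : P.[x] = teval p x.
  by rewrite horner_sum; apply: eq_bigr => i _; rewrite hornerZ hornerXn.
have P0 : P != 0.
  have lt_k : (k < tsize p)%N.
    by rewrite ltnNge; apply: contra pk => le_k; rewrite tcoef_default.
  apply: contraNneq pk => P0.
  have := congr1 (fun R : {poly K} => R`_(q ^ k)) P0; rewrite coef0 coef_sum.
  rewrite (bigD1 (Ordinal lt_k)) //= coefZ coefXn eqxx mulr1 big1 ?addr0 => [-> //|i ni].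
  rewrite coefZ coefXn eqn_exp2l // -[k]/(val (Ordinal lt_k)) val_eqE eq_sym.
  by rewrite (negbTE ni) mulr0.
exists (size P) => s s_uniq s0; apply: ltnW; apply: max_poly_roots => //.
by apply/allP => x /(allP s0); rewrite /root Px.
Qed.

(* A bounded type is finite only up to double negation: the enumeration cannot
   be computed, but it may be assumed to exist when deriving a contradiction. *)
Lemma bounded_enum (A : eqType) N :
  (forall s : seq A, uniq s -> (size s <= N)%N) ->
  (forall s : seq A, uniq s -> (forall x, x \in s) -> False) -> False.
Proof.
move=> leN noenum.
suff: forall k (s : seq A), uniq s -> (N - size s < k)%N -> False.
  by move=> /(_ N.+1 [::] isT); apply; rewrite subn0.
elim=> // k IH s s_uniq lt_k; apply: (noenum s) => // x; apply: contraT => nxs.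
have xs_uniq : uniq (x :: s) by rewrite /= nxs.
have /= leN' := leN _ xs_uniq; case: (IH _ xs_uniq).
by move: lt_k; rewrite /= ltnS; apply: leq_trans; rewrite subnSK.
Qed.

(** A section of [g] is an injection from [K^d2] to [K^d]. With [K] finite and [d <= d2], counting
    makes it bijective, and [g] is its inverse. *)
Lemma mxeval_surj_inj (s : seq K) d d2 (g : 'M[Ktau]_(d2, d)) :
  (forall x, x \in s) -> (d <= d2)%N ->
  (forall z, exists y, mxeval g y = z) -> injective (mxeval g).
Proof.
move=> s_all le_d g_surj.
pose toV k (x : {ffun 'I_k -> seq_sub s}) : 'cV[K]_k := \col_i val (x i).
have fromV k (v : 'cV[K]_k) : exists x, toV k x = v.
  exists [ffun i => SeqSub (s_all (v i 0))]; apply/colP => i.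
  by rewrite mxE ffunE.
have toV_inj k : injective (toV k).
  by move=> x y exy; apply/ffunP => i; apply: val_inj;
    have := congr1 (fun v : 'cV_k => v i 0) exy; rewrite !mxE.
have lift_g x : exists x', mxeval g (toV d x') = toV d2 x.
  by have [y <-] := g_surj (toV d2 x); have [x' <-] := fromV d y; exists x'.
have [h hE] := fin_all_exists lift_g.
have h_inj : injective h by move=> x y exy; apply: toV_inj; rewrite -!hE exy.
have [h' hK h'K] : bijective h.
  apply: inj_card_bij h_inj _; rewrite !card_ffun !card_ord leq_pexp2l //.
  by apply/card_gt0P; exists (SeqSub (s_all 0)).
move=> y z; have [y' <-] := fromV _ y; have [z' <-] := fromV _ z.
rewrite -[y']h'K -[z']h'K !hE => e; congr (toV _ (h _)).
exact: toV_inj e.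
Qed.

Lemma raises_weight_simple d (S : 'M[Ktau]_d) : raises_weight S -> tau_simple S.
Proof.
move=> S_raises d1 d2 T1 T2 f g _ _ [[_ gS] f_inj g_ker g_surj].
case: d1 => [|d1] in T1 f f_inj g_ker *; first by left.
case: d2 => [|d2] in T2 g gS g_ker g_surj *; first by right.
exfalso.
have g0 : g != 0.
  apply/negP => /eqP g0; have [y] := g_surj (const_mx 1).
  rewrite g0 => /(congr1 (fun v : 'cV_d2.+1 => v 0 0)).
  rewrite mxevalE mxE big1 => [/esym/eqP|i _]; first by rewrite oner_eq0.
  by rewrite mxE teval0.
have le_d : (d <= d2.+1)%N := morphism_dim S_raises gS g0.
have f1 : mxeval f (const_mx 1) != 0.
  apply/negP => /eqP f1; have := f_inj (const_mx 1) 0; rewrite f1 mxeval0.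
  move=> /(_ erefl) /(congr1 (fun v : 'cV_d1.+1 => v 0 0)) /eqP.
  by rewrite !mxE oner_eq0.
(* The sum over row [i] of [f] is the operator [y |-> f(y, ..., y)_i]. Its product with the
   annihilator [p] vanishes on all of [K], which bounds the size of [K]. *)
have [i fi] : exists i, \sum_c f i c != 0.
  case/cV0Pn: f1 => i; rewrite mxevalE => fi; exists i.
  apply: contraNneq fi => fi; have := congr1 (fun p => teval p 1) fi.
  rewrite teval_sum teval0 => e; rewrite -[X in _ == X]e; apply/eqP.
  by apply: eq_bigr => c _; rewrite mxE.
have [p p0 [w wg]] := morphism_annihilator S_raises gS g0 i.
have [N leN] := teval_roots (tmulf_neq0 p0 fi).
have K_le (s : seq K) : uniq s -> (size s <= N)%N.
  move=> s_uniq; apply: leN => //; apply/allP => y _; rewrite tevalM.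
  have -> : teval (\sum_c f i c) y = mxeval f (const_mx y) i 0.
    by rewrite mxevalE teval_sum; apply: eq_bigr => c _; rewrite mxE.
  have := congr1 (fun M : 'rV_d => mxeval M (mxeval f (const_mx y)) 0 0) wg.
  rewrite mxevalM (_ : mxeval g _ = 0); last by apply/g_ker; exists (const_mx y).
  rewrite mxeval0 mxE mxevalE (bigD1 i) //= big1 ?addr0 => [|c nci].
    by rewrite !mxE !eqxx mulr1 => <-.
  by rewrite !mxE (negbTE nci) mulr0 teval0.
apply: (bounded_enum K_le) => s s_uniq s_all.
have g_inj := mxeval_surj_inj s_all le_d g_surj.
(* The nonzero point [f(1, ..., 1)] lies in the kernel of [g], against injectivity. *)
case/eqP: f1; apply: g_inj; rewrite mxeval0.
by apply/g_ker; exists (const_mx 1).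
Qed.

End Simplicity.

(** * Duals and extensions by the Carlitz module *)

Section Criteria.
Variables (F : finFieldType) (K : fieldType) (gamma : {rmorphism {poly F} -> K}).
Local Notation q := #|F|.
Local Notation Ktau := (tpoly gamma).
Variables (n : nat) (T : 'M[Ktau]_n).
Hypothesis Tgood : good_triangular T.

Lemma dual_rankE a : (1 + (diag_rank T a).-1)%N = diag_rank T a.
Proof. by have [_ Trk _] := Tgood; rewrite add1n prednK // ltnW //; apply: Trk. Qed.

Lemma tmodule_const (P : 'M[Ktau]_n) : mxconst P = (theta gamma)%:M -> is_tmodule P.
Proof. by move=> P0; exists 0; split; [exists 1%N; rewrite expr1 | rewrite P0 addr0]. Qed.

End Criteria.

Lemma dual_coord_der0 (F : finFieldType) (K : fieldType)
    (gamma : {rmorphism {poly F} -> K}) n r (x : 'cV[K]_(\sum_(a < n) (r a).-1)) :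
  der0 (dual_coord gamma (r := r) x).
Proof.
apply/rowP => b; rewrite [LHS]mxE [RHS]mxE.
exact: (@tcoef_shift_coord_lt _ _ gamma n 1 (fun a => (r a).-1)).
Qed.

Lemma der0_carlitz (F : finFieldType) (K : fieldType)
    (gamma : {rmorphism {poly F} -> K}) n (X Y : 'rV[tpoly gamma]_n) :
  der0 (carlitz gamma *m X - Y) -> mxconst Y = theta gamma *: mxconst X.
Proof.
move=> XY0; apply/rowP => b; have := congr1 (fun M : 'rV_n => M 0 b) XY0.
rewrite carlitzM !mxE tcoefB tcoef_carlitzM addr0 => /eqP.
by rewrite subr_eq0 => /eqP.
Qed.

Lemma mxeval_Gadd (F : finFieldType) (K L : fieldType)
    (gamma : {rmorphism {poly F} -> K}) (gammaL : {rmorphism {poly F} -> L})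
    (j : {rmorphism K -> L}) n x : Afield_ext gamma gammaL j ->
  mxeval (base_change gammaL j (Gadd gamma n)) x = theta gammaL *: x.
Proof.
move=> eL; apply/colP => b; rewrite mxevalE (bigD1 b) //= big1 ?addr0 => [|c ncb].
  by rewrite base_changeE mxE eqxx mulr1n tmap_const teval_const -eL mxE.
by rewrite base_changeE mxE eq_sym (negbTE ncb) tmap0 teval0.
Qed.

Lemma der0_subr (F : finFieldType) (K : fieldType)
    (gamma : {rmorphism {poly F} -> K}) n (X Y : 'rV[tpoly gamma]_n) :
  der0 (X - Y) -> mxconst X = mxconst Y.
Proof.
move=> XY0; apply/rowP => b; have := congr1 (fun M : 'rV_n => M 0 b) XY0.
by rewrite !mxE tcoefB => /eqP; rewrite subr_eq0 => /eqP.
Qed.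

Section Duals.
Variables (F : finFieldType) (K : fieldType) (gamma : {rmorphism {poly F} -> K}).
Local Notation q := #|F|.
Local Notation Ktau := (tpoly gamma).

Lemma shift_coord_eqK n e (r : 'I_n -> nat) (T : 'M[Ktau]_n)
    (x y : 'cV[K]_(\sum_a r a)) :
  good_triangular T -> (forall a, (e + r a)%N = diag_rank T a) ->
  der_in T (carlitz gamma) (shift_coord gamma e x - shift_coord gamma e y) -> x = y.
Proof.
move=> Tgood er Dxy.
apply: (shift_coord_eq Tgood er (gammaL := gamma) (j := idfun)) => //.
by rewrite base_change_id.
Qed.

(** Only the action remains to be supplied: representatives come from reduction, and membership in
    Der_in,0 from the absence of nilpotence. *)
Lemma is_dual_intro n (T : 'M[Ktau]_n) (P : 'M[Ktau]_(dual_dim T)) :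
  good_triangular T -> mxconst P = (theta gamma)%:M ->
  (forall (L : fieldType) (gammaL : {rmorphism {poly F} -> L})
      (j : {rmorphism K -> L}), Afield_ext gamma gammaL j -> forall x,
      der_in (base_change gammaL j T) (carlitz gammaL)
        (carlitz gammaL *m dual_coord gammaL (r := diag_rank T) x
         - dual_coord gammaL (r := diag_rank T) (mxeval (base_change gammaL j P) x))) ->
  is_dual T P.
Proof.
move=> Tgood P0 PT; split; first exact: tmodule_const.
move=> L gammaL j eL; have [_ _ TL0] := good_base_change eL Tgood; split.
- exact: dual_coord_der0.
- move=> D D0; have [|x [Dx x_uniq]] :=
    shift_coord_repr Tgood (leqnn 1) (dual_rankE Tgood) eL (D := D).
    move=> b [|//] _; have := congr1 (fun M : 'rV_n => M 0 b) D0.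
    by rewrite !mxE.
  exists x; split=> [|y [Dy _]]; last exact: x_uniq.
  by split=> //; apply: der_in_der0 TL0 Dx.
- by move=> x; split; [|apply: der_in_der0 TL0 _]; apply: PT.
Qed.

Lemma is_ext_intro n (T : 'M[Ktau]_n) (P : 'M[Ktau]_(ext_dim T)) :
  good_triangular T -> mxconst P = (theta gamma)%:M ->
  (forall (L : fieldType) (gammaL : {rmorphism {poly F} -> L})
      (j : {rmorphism K -> L}), Afield_ext gamma gammaL j -> forall x,
      der_in (base_change gammaL j T) (carlitz gammaL)
        (carlitz gammaL *m ext_coord gammaL (r := diag_rank T) x
         - ext_coord gammaL (r := diag_rank T) (mxeval (base_change gammaL j P) x))) ->
  is_ext T P.
Proof.
move=> Tgood P0 PT; split; first exact: tmodule_const.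
move=> L gammaL j eL; split=> // [D _ | x]; last exact: PT.
exact: (shift_coord_repr Tgood (leq0n 1) (fun _ => erefl) eL (D := D)).
Qed.

Lemma is_dual_action n (T : 'M[Ktau]_n) (P : 'M[Ktau]_(dual_dim T)) :
  is_dual T P ->
  forall (L : fieldType) (gammaL : {rmorphism {poly F} -> L})
      (j : {rmorphism K -> L}), Afield_ext gamma gammaL j -> forall x,
      der_in (base_change gammaL j T) (carlitz gammaL)
        (carlitz gammaL *m dual_coord gammaL (r := diag_rank T) x
         - dual_coord gammaL (r := diag_rank T) (mxeval (base_change gammaL j P) x)).
Proof. by move=> [_ PT] L gammaL j eL x; have [_ _ /(_ x)[]] := PT L gammaL j eL. Qed.

Lemma dual_exists n (T : 'M[Ktau]_n) : good_triangular T ->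
  {P : 'M[Ktau]_(dual_dim T) | is_dual T P}.
Proof.
move=> Tgood; have [P PT P0] := represent_action Tgood (leqnn 1) (dual_rankE Tgood).
by exists P; apply: is_dual_intro.
Qed.

Lemma dual_induced_exists n n' (T : 'M[Ktau]_n) (T' : 'M[Ktau]_n') f :
  good_triangular T ->
  {h : 'M[Ktau]_(dual_dim T, dual_dim T') | dual_induced T T' f h}.
Proof.
move=> Tgood.
have [h hP] := represent_induced Tgood (leqnn 1) (dual_rankE Tgood)
  (fun a => (diag_rank T' a).-1) f (leqnn 1).
exists h => L gammaL j eL x; have [_ _ TL0] := good_base_change eL Tgood.
by split; [|apply: der_in_der0 TL0 _]; apply: hP.
Qed.

Lemma dual_induced_morphism n n' (T : 'M[Ktau]_n) (T' : 'M[Ktau]_n') f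
    (P : 'M[Ktau]_(dual_dim T)) (P' : 'M[Ktau]_(dual_dim T')) h :
  good_triangular T -> is_dual T P -> is_dual T' P' -> is_morphism T T' f ->
  dual_induced T T' f h -> is_morphism P' P h.
Proof.
move=> Tgood /is_dual_action PT /is_dual_action PT' fT hP.
apply: (induced_morphism Tgood (dual_rankE Tgood) (r' := fun a => (diag_rank T' a).-1)
  (e' := 1) fT) => L gammaL j eL x.
split=> [|x'|x']; [exact: PT | exact: PT' |].
by have [] := hP L gammaL j eL x'.
Qed.

(** * The exact sequence from the dual through Ext to [Ga^n] *)

Section ExtSequence.
Variables (n : nat) (T : 'M[Ktau]_n) (P : 'M[Ktau]_(dual_dim T)).
Hypotheses (Tgood : good_triangular T) (PT : is_dual T P).

Let er1 := dual_rankE Tgood.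
Let er0 (a : 'I_n) : (0 + diag_rank T a)%N = diag_rank T a := erefl.

Lemma ext_constant_term_exists :
  {g : 'M[Ktau]_(n, ext_dim T) | ext_constant_term T g}.
Proof.
exists (\matrix_(b, k)
  if (tagnat.sig1 k == b) && (tagnat.sig2 k == 0%N :> nat) then 1 else 0).
move=> L gammaL j eL x; apply/colP => b; rewrite mxevalE [RHS]mxE [RHS]mxE.
rewrite -[RHS]/(tcoef (shift_coord gammaL 0 x 0 b) 0) shift_coord_sum summxE tcoef_sum.
apply: eq_bigr => k _; rewrite base_changeE !mxE eqxx /= eq_sym.
case: eqP => _ /=; last by rewrite tmap0 teval0 mulr0 tcoef0.
rewrite mulr1 tcoef_constM tcoef_tauX add0n eq_sym.
by case: eqP => _; rewrite ?tmap1 ?teval1 ?mulr1 // tmap0 teval0 mulr0.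
Qed.

Lemma ext_sequence :
  exists E i p,
    [/\ is_ext T E, dual_ext_inclusion T i, ext_constant_term T p
      & short_exact P E (Gadd gamma n) i p].
Proof.
have [E ET E0] := represent_action Tgood (leq0n 1) er0.
have [i iP] := represent_induced Tgood (leq0n 1) er0
  (fun a => (diag_rank T a).-1) 1%:M (leq0n 1).
have [p pP] := ext_constant_term_exists.
have iP' : dual_ext_inclusion T i.
  by move=> L gammaL j eL x; have := iP L gammaL j eL x; rewrite base_change1 mulmx1.
have iK x : der_in T (carlitz gamma)
    (dual_coord gamma (r := diag_rank T) x
     - ext_coord gamma (r := diag_rank T) (mxeval i x)).
  by have := iP' K gamma idfun (fun _ => erefl) x; rewrite !base_change_id.
have pK x : mxeval p x = (mxconst (ext_coord gamma (r := diag_rank T) x))^T.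
  by have := pP K gamma idfun (fun _ => erefl) x; rewrite !base_change_id.
have [_ Trk T0] := Tgood.
exists E, i, p; split=> //; first exact: is_ext_intro.
split.
- split.
    apply: (induced_morphism Tgood er0 (r' := fun a => (diag_rank T a).-1) (e' := 1)
      (T' := T) (f := 1%:M)) => [|L gammaL j eL x].
      by rewrite /is_morphism mul1mx mulmx1.
    split; [exact: ET | exact: is_dual_action PT _ _ _ eL | exact: iP].
  (* [C_t D] and its reduced form differ by an inner biderivation, which has no constant term, so
     [t] acts on constant terms by theta. *)
  apply: mxeval_faithful => L gammaL j eL x; rewrite !base_changeM !mxevalM.
  rewrite !pP //; have [_ _ TL0] := good_base_change eL Tgood.
  by rewrite (der0_carlitz (der_in_der0 TL0 (ET L gammaL j eL x))) mxeval_Gadd // linearZ.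
- apply: mxeval_inj => x ix0.
  have := iK x; rewrite ix0 -[ext_coord _ _]/(shift_coord gamma 0 0) shift_coord0 subr0.
  have -> : dual_coord gamma (r := diag_rank T) x
     = shift_coord gamma 1 x - shift_coord gamma 1 (0 : 'cV_(dual_dim T)).
    by rewrite shift_coord0 subr0.
  by apply: (shift_coord_eqK Tgood er1).
- move=> y; split=> [py0 | [x <-]]; last first.
    rewrite pK -(der0_subr (der_in_der0 T0 (iK x))).
    by rewrite (@dual_coord_der0 _ _ gamma n (diag_rank T) x) trmx0.
  (* A reduced biderivation without constant term is already in dual coordinates. *)
  have [b k|x ex] := @shift_coord_surj _ _ gamma n 1 (fun a => (diag_rank T a).-1)
      (shift_coord gamma 0 y).
    rewrite er1 => /orP[|le_k]; last by rewrite tcoef_shift_coord_ge.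
    rewrite ltnS leqn0 => /eqP ->; have := congr1 (fun v : 'cV_n => v b 0) py0.
    by rewrite pK !mxE.
  exists x; apply/esym/(shift_coord_eqK Tgood er0); rewrite ex; exact: iK.
(* The biderivation with constant entries [z] is reduced, because all ranks are positive. *)
- move=> z; pose D : 'rV[Ktau]_n := \row_b tconst gamma (z b 0).
  have [b k|y ey] := @shift_coord_surj _ _ gamma n 0 (diag_rank T) D.
    rewrite mxE tcoef_tconst /= => le_k; rewrite gtn_eqF // (leq_trans _ le_k) //.
    by apply: ltnW; apply: Trk.
  exists y; rewrite pK -[ext_coord _ _]/(shift_coord gamma 0 y) -ey.
  by apply/colP => b; rewrite !mxE tcoef_tconst.
Qed.

End ExtSequence.

End Duals.

(** * Exact sequences of duals attached to a block *)

Section Blocks.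
Variables (F : finFieldType) (K : fieldType) (gamma : {rmorphism {poly F} -> K}).
Local Notation q := #|F|.
Local Notation Ktau := (tpoly gamma).

Lemma block_projE l b : block_proj gamma l 0 b = (b == ord0)%:R.
Proof.
rewrite /block_proj mxE; case: splitP => c.
  rewrite ord1 => /= b0; have -> : b = ord0 by apply: val_inj.
  by rewrite mxE !eqxx.
by move=> /= bc; rewrite mxE; case: eqP => // b0; move: bc; rewrite b0.
Qed.

Lemma block_inclE l c b : block_incl gamma l c b = (c == lift ord0 b)%:R.
Proof.
rewrite /block_incl mxE -val_eqE /=; case: splitP => c' /= ->; rewrite mxE.
  by rewrite ord1.
by rewrite -val_eqE.
Qed.

Lemma mul_block_proj l (D : 'rV[Ktau]_1) b :
  (D *m block_proj gamma l) 0 b = if b == ord0 then D 0 0 else 0.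
Proof.
by rewrite mxE big_ord1 block_projE; case: eqP => _; rewrite ?mulr1 ?mulr0.
Qed.

Lemma mul_block_incl m l (D : 'M[Ktau]_(m, l.+1)) c b :
  (D *m block_incl gamma l) c b = D c (lift ord0 b).
Proof.
rewrite mxE (bigD1 (lift ord0 b)) //= big1 ?addr0 => [|d ndb].
  by rewrite block_inclE eqxx mulr1.
by rewrite block_inclE (negbTE ndb) mulr0.
Qed.

Variables (l : nat) (T1 : 'M[Ktau]_1) (T : 'M[Ktau]_l.+1) (T0 : 'M[Ktau]_l).
Hypotheses (T1good : good_triangular T1) (Tgood : good_triangular T).
Hypothesis T0good : good_triangular T0.
Hypothesis rank0 : diag_rank T ord0 = diag_rank T1 ord0.
Hypothesis rankS : forall b, diag_rank T (lift ord0 b) = diag_rank T0 b.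
Hypothesis projT : is_morphism T T1 (block_proj gamma l).
Hypothesis inclT : is_morphism T0 T (block_incl gamma l).
Variables (P1 : 'M[Ktau]_(dual_dim T1)) (P : 'M[Ktau]_(dual_dim T)).
Variables (P0 : 'M[Ktau]_(dual_dim T0)).
Hypotheses (P1T : is_dual T1 P1) (PT : is_dual T P) (P0T : is_dual T0 P0).
Variables (i : 'M[Ktau]_(dual_dim T, dual_dim T1)).
Variables (p : 'M[Ktau]_(dual_dim T0, dual_dim T)).
Hypothesis iP : dual_induced T T1 (block_proj gamma l) i.
Hypothesis pP : dual_induced T0 T (block_incl gamma l) p.

(** On reduced representatives, [i] is extension by zero and [p] deletes the first column. Both keep
    representatives reduced because the ranks match, so exactness can be checked on them. *)
Lemma dual_block_exact : short_exact P1 P P0 i p.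
Proof.
pose sc n (U : 'M[Ktau]_n) (x : 'cV[K]_(dual_dim U)) :=
  shift_coord gamma 1 (r := fun a => (diag_rank U a).-1) x.
have iK x : der_in T (carlitz gamma)
    (sc _ T1 x *m block_proj gamma l - sc _ T (mxeval i x)).
  by have [] := @iP K gamma idfun (fun _ => erefl) x; rewrite !base_change_id.
have pK x : der_in T0 (carlitz gamma)
    (sc _ T x *m block_incl gamma l - sc _ T0 (mxeval p x)).
  by have [] := @pP K gamma idfun (fun _ => erefl) x; rewrite !base_change_id.
have scE n (U : 'M[Ktau]_n) (Ugood : good_triangular U) x y :
    der_in U (carlitz gamma) (sc _ U x - sc _ U y) -> x = y.
  exact: shift_coord_eqK (dual_rankE Ugood).
have sc0 n (U : 'M[Ktau]_n) : sc _ U 0 = 0 by apply: shift_coord0.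
have sc_surj n (U : 'M[Ktau]_n) (Ugood : good_triangular U) (D : 'rV[Ktau]_n) :
    (forall b k, (k < 1)%N || (diag_rank U b <= k)%N -> tcoef (D 0 b) k = 0) ->
    exists x, D = sc _ U x.
  move=> D0; apply: shift_coord_surj => b k; rewrite (dual_rankE Ugood).
  exact: D0.
have sc_out n (U : 'M[Ktau]_n) (Ugood : good_triangular U) x b k :
    (k < 1)%N || (diag_rank U b <= k)%N -> tcoef (sc _ U x 0 b) k = 0.
  case/orP; first exact: tcoef_shift_coord_lt.
  by rewrite -(dual_rankE Ugood); apply: tcoef_shift_coord_ge.
have sc_inj n (U : 'M[Ktau]_n) x y : sc _ U x = sc _ U y -> x = y.
  exact: shift_coord_inj.
have ext0 (D : 'rV[Ktau]_1) :
    (forall b k, (k < 1)%N || (diag_rank T1 b <= k)%N -> tcoef (D 0 b) k = 0) ->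
    forall b k, (k < 1)%N || (diag_rank T b <= k)%N ->
    tcoef ((D *m block_proj gamma l) 0 b) k = 0.
  move=> D0 b k; rewrite mul_block_proj; case: eqP => [-> | _ _]; last by rewrite tcoef0.
  by rewrite rank0; apply: D0.
split.
- by split; [apply: dual_induced_morphism iP | apply: dual_induced_morphism pP].
- apply: mxeval_inj => x ix0; apply: (sc_inj _ T1); rewrite sc0.
  have := iK x; rewrite ix0 sc0 subr0 => /(der_in_reduced_eq0 Tgood) D0.
  apply/rowP => b; rewrite ord1 [RHS]mxE.
  have := mul_block_proj (sc _ T1 x) (ord0 : 'I_l.+1); rewrite eqxx => <-.
  rewrite D0 ?mxE // => b' k le_k.
  apply: ext0; last by rewrite le_k orbT.
  by move=> b'' k'; apply: sc_out.
- move=> y; split=> [py0 | [x <-]]; last first.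
    apply: (scE _ T0 T0good); rewrite sc0 subr0.
    have := der_in_comp inclT (iK x); rewrite mulmxBl.
    have -> : sc _ T1 x *m block_proj gamma l *m block_incl gamma l = 0.
      by apply/rowP => b; rewrite mul_block_incl mul_block_proj [RHS]mxE.
    rewrite sub0r => /der_inN; rewrite opprK => i1.
    by have := der_inB i1 (pK (mxeval i x)); rewrite subKr.
  (* The restriction to the other columns is reduced and inner, hence zero, so [y] is supported in
     the first column. *)
  have y0 b : sc _ T y 0 (lift ord0 b) = 0.
    have := pK y; rewrite py0 sc0 subr0 => /(der_in_reduced_eq0 T0good) D0.
    rewrite -mul_block_incl D0 ?mxE // => b' k le_k.
    by rewrite mul_block_incl; apply: sc_out; rewrite ?rankS ?le_k ?orbT.
  have [|x ex] := sc_surj _ T1 T1good (\row__ sc _ T y 0 ord0).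
    move=> b k; rewrite mxE ord1 -rank0; exact: sc_out.
  exists x; apply/esym/(scE _ T Tgood).
  suff -> : sc _ T y = sc _ T1 x *m block_proj gamma l by apply: iK.
  apply/rowP => b; rewrite mul_block_proj -ex mxE.
  by case: (unliftP ord0 b) => [b' ->|->] //=; rewrite y0.
- move=> z; pose D : 'rV[Ktau]_l.+1 :=
    \row_b if unlift ord0 b is Some b' then sc _ T0 z 0 b' else 0.
  have [|y ey] := sc_surj _ T Tgood D.
    move=> b k; rewrite mxE; case: (unliftP ord0 b) => [b' ->|_]; last by rewrite tcoef0.
    by rewrite rankS; apply: sc_out.
  exists y; apply/esym/(scE _ T0 T0good).
  suff -> : sc _ T0 z = sc _ T y *m block_incl gamma l by apply: pK.
  by apply/rowP => b; rewrite mul_block_incl -ey [RHS]mxE liftK.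
Qed.

End Blocks.

(** * The explicit dual of a Drinfeld module *)

Section DrinfeldDual.
Variables (F : finFieldType) (K : fieldType) (gamma : {rmorphism {poly F} -> K}).
Local Notation q := #|F|.
Local Notation Ktau := (tpoly gamma).

(* In reduced coordinates x_1, ..., x_d (d = r - 1) the dual of
   psi = theta + a_1 tau + ... + a_r tau^r is
   x_k |-> theta x_k + x_(k-1)^q - (a_k / a_r) x_d^q, to which
   (x_d^q / a_r)^q is added for k = 1. *)
Definition drinfeld_dual (psi : Ktau) d : 'M[Ktau]_d :=
  let r := trank psi in
  \matrix_(k, j)
    (tconst gamma (theta gamma *+ (k == j))
     + tconst gamma ((k == j.+1 :> nat)%:R
                     - (tcoef psi k.+1 / tcoef psi r) *+ (j.+1 == d)) * tau gamma
     + tconst gamma ((tcoef psi r ^- q) *+ ((k == 0%N :> nat) && (j.+1 == d)))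
         * tau gamma ^+ 2).

Lemma tcoef_drinfeld_dual psi d (k j : 'I_d) t :
  tcoef (drinfeld_dual psi d k j) t =
    if t == 0%N then theta gamma *+ (k == j)
    else if t == 1%N then
      (k == j.+1 :> nat)%:R - (tcoef psi k.+1 / tcoef psi (trank psi)) *+ (j.+1 == d)
    else if t == 2%N then
      (tcoef psi (trank psi) ^- q) *+ ((k == 0%N :> nat) && (j.+1 == d))
    else 0.
Proof.
rewrite mxE !tcoefD tcoef_tconst !tcoef_constM tcoef_tauX tcoefX.
by case: t => [|[|[|t]]]; rewrite /= ?mulr0 ?mulr1 ?addr0 ?add0r.
Qed.

(** The extremal terms are [tau] at [(k, k - 1)] for [k > 0] and [a_r^(-q) tau^2] at [(0, d - 1)];
    each raises the weight by exactly [d + 1]. *)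
Lemma drinfeld_dual_raises (psi : Ktau) d :
  (0 < trank psi)%N -> raises_weight (drinfeld_dual psi d).
Proof.
move=> psi_gt0; have ar0 := tcoef_trank_neq0 psi_gt0; split=> [k j t | k].
  have := ltn_ord k; have := ltn_ord j; rewrite tcoef_drinfeld_dual.
  case: t => [|[|[|t]]] //= ltj ltk; rewrite ?mul0n ?mul1n => lt_w.
  - by have -> : (k == j) = false by rewrite -val_eqE /=; lia.
  - have -> : (k == j.+1 :> nat) = false by lia.
    have -> : (j.+1 == d) = false by lia.
    by rewrite mulr0n subr0.
  - by have -> : (k == 0%N :> nat) && (j.+1 == d) = false by lia.
have ltk := ltn_ord k; case: (posnP k) => [k0 | k_gt0].
  have lt_d : (d.-1 < d)%N by lia.
  exists (Ordinal lt_d), 2; split; first by rewrite /=; lia.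
  rewrite tcoef_drinfeld_dual /= k0 prednK ?eqxx ?mulr1n ?invr_eq0 ?expf_neq0 //; lia.
have lt_k : (k.-1 < d)%N by lia.
exists (Ordinal lt_k), 1%N; split; first by rewrite /=; lia.
rewrite tcoef_drinfeld_dual /= prednK // eqxx.
have -> : (k == d :> nat) = false by lia.
by rewrite mulr0n subr0 oner_neq0.
Qed.

End DrinfeldDual.

Section Drinfeld.
Variables (F : finFieldType) (K : fieldType) (gamma : {rmorphism {poly F} -> K}).
Local Notation q := #|F|.
Local Notation Ktau := (tpoly gamma).

Lemma dual_dim_scalar (psi : Ktau) : dual_dim (psi%:M : 'M_1) = (trank psi).-1.
Proof. by rewrite /dual_dim big_ord1 /diag_rank mxE eqxx mulr1n. Qed.

Lemma scalar_good (psi : Ktau) :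
  is_drinfeld psi -> (1 < trank psi)%N -> good_triangular (psi%:M : 'M_1).
Proof.
move=> [psi0 _] psi_gt1; split.
- by move=> a b; rewrite !ord1.
- by move=> a; rewrite ord1 mxE eqxx mulr1n.
- by apply/matrixP => a b; rewrite !ord1 !mxE eqxx !mulr1n.
Qed.

Lemma tcoef_shift_coord1 (r : 'I_1 -> nat) 
    (x : 'cV[K]_(\sum_(a < 1) r a)) (k : 'I_(\sum_(a < 1) r a)) :
  tcoef (shift_coord gamma 1 x 0 0) k.+1 = x k 0.
Proof.
(* With a single block, the position inside the block is the index itself. *)
have sig2k : tagnat.sig2 k = k :> nat.
  by rewrite [RHS]tagnat.rect big1 // => i; rewrite !ord1 ltnn.
rewrite -[in RHS](tagnat.sig2K k) -(tcoef_shift_coordD gamma 1) add1n sig2k.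
by rewrite (ord1 (tagnat.sig1 k)).
Qed.

Lemma sum_mulrb_pick (V : nmodType) m (P : pred 'I_m) (f : 'I_m -> V) c :
  (forall i, P i = (i == c)) -> \sum_i f i *+ P i = f c.
Proof.
move=> Pc; rewrite (bigD1 c) //= Pc eqxx mulr1n big1 ?addr0 // => i nic.
by rewrite Pc (negbTE nic) mulr0n.
Qed.

End Drinfeld.

Section DrinfeldDualAction.
Variables (F : finFieldType) (K L : fieldType).
Variables (gamma : {rmorphism {poly F} -> K}) (gammaL : {rmorphism {poly F} -> L}).
Variables (j : {rmorphism K -> L}) (eL : Afield_ext gamma gammaL j).
Local Notation q := #|F|.
Local Notation Ktau := (tpoly gamma).
Variables (psi : Ktau).
Hypotheses (psi0 : tcoef psi 0 = theta gamma) (psi_gt1 : (1 < trank psi)%N).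

Local Notation ar := (tcoef psi (trank psi)).

Lemma mxeval_drinfeld_dual (d : nat) (l k : 'I_d) (x : 'cV[L]_d) :
  l.+1 = d ->
  mxeval (base_change gammaL j (drinfeld_dual psi d)) x k 0
    = theta gammaL * x k 0
      + (\sum_(i < d) x i 0 ^+ q *+ (k == i.+1 :> nat))
      - (j (tcoef psi k.+1 / ar) * x l 0 ^+ q)
      + (j (ar ^- q) * x l 0 ^+ (q ^ 2)) *+ (k == 0%N :> nat).
Proof.
move=> ld.
have pick_l (i : 'I_d) : (i.+1 == d) = (i == l).
  by rewrite -val_eqE /=; lia.
have ev i : teval (base_change gammaL j (drinfeld_dual psi d) k i) (x i 0)
    = theta gammaL * x i 0 *+ (k == i) + x i 0 ^+ q *+ (k == i.+1 :> nat)
      - j (tcoef psi k.+1 / ar) * x i 0 ^+ q *+ (i.+1 == d)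
      + (j (ar ^- q) * x i 0 ^+ (q ^ 2)) *+ (k == 0%N :> nat) *+ (i.+1 == d).
  rewrite base_changeE mxE !tmapD !tmapM !tmap_const tmap_tau !tevalD !teval_constM.
  rewrite teval_const teval_tauM !teval_tau -exprM mulnn.
  rewrite !(rmorphMn j) rmorphB (rmorph_nat j) mulrBl rmorphMn.
  rewrite /theta eL addrA; congr (_ + _ - _ + _); rewrite ?mulrnAl ?mul1r //.
  by rewrite -mulrnA -mulnb mulnC.
rewrite mxevalE (eq_bigr _ (fun i _ => ev i)) !big_split /= sumrN.
rewrite (@sum_mulrb_pick _ _ _ _ k); last by move=> i; rewrite eq_sym.
by rewrite !(@sum_mulrb_pick _ _ (fun i : 'I_d => i.+1 == d) _ l).
Qed.

(** [C_t D] overflows only by [x_d^q tau^r]. The inner biderivation of [U = x_d^q / a_r] removes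
    this term, and its part [C_t U] gives back [U^q tau], the source of the [tau^2] term of the
    matrix. *)
Lemma drinfeld_dual_action (x : 'cV[L]_(dual_dim (psi%:M : 'M_1))) :
  der_in (base_change gammaL j (psi%:M : 'M_1)) (carlitz gammaL)
    (carlitz gammaL *m dual_coord gammaL (r := diag_rank (psi%:M : 'M_1)) x
     - dual_coord gammaL (r := diag_rank (psi%:M : 'M_1))
         (mxeval (base_change gammaL j (drinfeld_dual psi _)) x)).
Proof.
set d := dual_dim _ in x *.
have dE : d.+1 = trank psi by rewrite /d dual_dim_scalar prednK // ltnW.
have ar0 : ar != 0 by apply: tcoef_trank_neq0; apply: ltnW.
have lt_l : (d.-1 < d)%N by lia.
pose l : 'I_d := Ordinal lt_l; have ld : l.+1 = d by rewrite /=; lia.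
pose u := j ar^-1 * x l 0 ^+ q.
have -> : base_change gammaL j (psi%:M : 'M_1) = (tmap gammaL j psi)%:M.
  by apply/matrixP => a b; rewrite !ord1 base_changeE !mxE eqxx !mulr1n.
exists (tconst gammaL u)%:M; apply/rowP => b; rewrite ord1 {b}.
pose sc (y : 'cV[L]_d) := shift_coord gammaL 1
  (r := fun a => (diag_rank (psi%:M : 'M_1) a).-1) y.
have sc0 y : tcoef (sc y 0 0) 0 = 0 by apply: tcoef_shift_coord_lt.
have scS y (k : 'I_d) : tcoef (sc y 0 0) k.+1 = y k 0 by apply: tcoef_shift_coord1.
have sc_ge y k : (d < k)%N -> tcoef (sc y 0 0) k = 0.
  move=> lt_dk; apply: tcoef_shift_coord_ge; rewrite add1n prednK; last first.
    by rewrite /diag_rank mxE eqxx mulr1n ltnW.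
  by rewrite /diag_rank mxE eqxx mulr1n -dE.
have E1 (X Y : 'rV[tpoly gammaL]_1) : (carlitz gammaL *m X - Y) 0 0
    = (tconst gammaL (theta gammaL) + tau gammaL) * X 0 0 - Y 0 0.
  by rewrite carlitzM !mxE.
have -> : forall X Y,
    (carlitz gammaL *m dual_coord gammaL (r := diag_rank (psi%:M : 'M_1)) X
     - dual_coord gammaL (r := diag_rank (psi%:M : 'M_1)) Y) 0 0
    = (tconst gammaL (theta gammaL) + tau gammaL) * sc X 0 0 - sc Y 0 0.
  by move=> X Y; apply: E1.
have -> : ((tconst gammaL u)%:M *m (tmap gammaL j psi)%:M
      - carlitz gammaL *m (tconst gammaL u)%:M) 0 0
    = tconst gammaL u * tmap gammaL j psi
      - (tconst gammaL (theta gammaL) + tau gammaL) * tconst gammaL u.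
  by rewrite carlitzM -scalar_mxM !mxE eqxx !mulr1n.
apply: tpoly_ext => k; rewrite !tcoefB !tcoef_carlitzM tcoef_constM tcoef_map.
have qz : (0 : L) ^+ q = 0 by rewrite -[q]expn1 expr0_card.
have jth : j (theta gamma) = theta gammaL by rewrite /theta eL.
case: k => [|k].
  by rewrite !sc0 mulr0 !addr0 subr0 tcoef_tconst psi0 jth mulrC subrr.
rewrite tcoef_tconst mulr0 add0r.
(* Degree [k + 1] is a coordinate for [k < d], exceeds the rank for [k > d], and is the rank for
   [k = d], where [u] was chosen to make both sides agree. *)
have [lt_kd | lt_dk | e_kd] := ltngtP k d.
- rewrite -[k]/(val (Ordinal lt_kd)) !scS (mxeval_drinfeld_dual _ _ ld) /=.
  have -> : \sum_(i < d) x i 0 ^+ q *+ (k == i.+1) = tcoef (sc x 0 0) k ^+ q.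
    case: k lt_kd => [|k] lt_kd.
      by rewrite sc0 qz big1 // => i _.
    rewrite -[k]/(val (Ordinal (ltnW lt_kd))) scS.
    rewrite (@sum_mulrb_pick _ _ _ _ (Ordinal (ltnW lt_kd))) // => i.
    by rewrite eqSS eq_sym.
  have -> : j (tcoef psi k.+1 / ar) * x l 0 ^+ q = u * j (tcoef psi k.+1).
    by rewrite rmorphM /u [in RHS]mulrC mulrA.
  have -> : (j (ar ^- q) * x l 0 ^+ (q ^ 2)) *+ (k == 0%N)
      = tcoef (tconst gammaL u) k ^+ q.
    rewrite tcoef_tconst; case: eqP => _; last by rewrite mulr0n qz.
    by rewrite mulr1n /u exprMn -rmorphXn exprVn -exprM -mulnn.
  by rewrite opprD addrA subKr.
- have lt_k1 : (d < k.+1)%N := leqW lt_dk.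
  rewrite (sc_ge x k.+1) // (sc_ge x k) // (sc_ge _ k.+1) // qz mulr0 addr0 subr0.
  have lt_tr : (trank psi < k.+1)%N by rewrite -dE ltnS.
  rewrite (tcoef_trank lt_tr) rmorph0 mulr0 sub0r tcoef_tconst gtn_eqF.
    by rewrite qz oppr0.
  exact: leq_ltn_trans (leq0n d) lt_dk.
- have lt_k1 : (d < k.+1)%N by rewrite e_kd.
  rewrite (sc_ge x k.+1) // (sc_ge _ k.+1) // mulr0 add0r subr0.
  have -> : k.+1 = trank psi by rewrite e_kd dE.
  have -> : k = l.+1 by rewrite e_kd ld.
  rewrite scS tcoef_tconst qz subr0 /u mulrAC -rmorphM mulVf // rmorph1.
  by rewrite mul1r.
Qed.

End DrinfeldDualAction.

(** * Triangular t-modules *)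

Section Triangular.
Variables (F : finFieldType) (K : fieldType) (gamma : {rmorphism {poly F} -> K}).
Local Notation Ktau := (tpoly gamma).
Variables (psi : nat -> Ktau) (delta : nat -> nat -> Ktau).

Lemma triangular_good n l :
  admissible psi delta n -> (l <= n)%N -> good_triangular (triangular psi delta l).
Proof.
move=> [psiD nil0 psi_rk] le_ln.
have in_range (a : 'I_l) : (1 <= l - a <= n)%N by have := ltn_ord a; lia.
split=> [a b lt_ab | a |].
- have := ltn_ord b; rewrite mxE => lt_b.
  have -> : (l - a == l - b)%N = false by lia.
  by have -> : (l - a < l - b)%N = false by lia.
- by rewrite mxE eqxx; apply: psi_rk.
(* The block of size [l] starts at row and column [n - l] of the matrix of size [n], from which it
   inherits the absence of nilpotence. *)
apply/matrixP => a b; have lt_n (c : 'I_l) : (n - l + c < n)%N by have := ltn_ord c; lia.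
have := congr1 (fun M : 'M_n => M (Ordinal (lt_n a)) (Ordinal (lt_n b))) nil0.
have sub_n (c : 'I_l) : (n - (n - l + c) = l - c)%N by have := ltn_ord c; lia.
by rewrite !mxE /= !sub_n => ->; rewrite -!val_eqE /= eqn_add2l.
Qed.

Lemma triangular_proj l :
  is_morphism (triangular psi delta l.+1) (psi l.+1)%:M (block_proj gamma l).
Proof.
apply/rowP => b; rewrite mul_scalar_mx mxE (bigD1 ord0) //= big1 ?addr0 => [|c nc0].
  rewrite [RHS]mxE !block_projE eqxx mul1r mxE subn0 -val_eqE /=.
  have [-> | b_gt0] := posnP b; first by rewrite subn0 eqxx mulr1.
  rewrite mulr0; have -> : (l.+1 == l.+1 - b)%N = false by lia.
  by have -> : (l.+1 < l.+1 - b)%N = false by lia.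
by rewrite block_projE (negbTE nc0) mul0r.
Qed.

Lemma triangular_incl l :
  is_morphism (triangular psi delta l) (triangular psi delta l.+1) (block_incl gamma l).
Proof.
apply/matrixP => c b; rewrite mul_block_incl [RHS]mxE mxE.
under eq_bigr => k _ do rewrite block_inclE mxE.
have lt_b := ltn_ord b; case: (unliftP ord0 c) => [c' -> | ->].
  rewrite (bigD1 c') //= big1 ?addr0 => [|k nk].
    by rewrite eqxx mul1r !subSS.
  by rewrite (inj_eq lift_inj) eq_sym (negbTE nk) mul0r.
rewrite big1 => [|k _]; last by rewrite (negbTE (neq_lift _ _)) mul0r.
rewrite /= subn0 subSS; have -> : (l.+1 == l - b)%N = false by lia.
by have -> : (l.+1 < l - b)%N = false by lia.
Qed.

End Triangular.

Theorem theorem8p2 (F : finFieldType) (K : fieldType)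
    (gamma : {rmorphism {poly F} -> K}) (n : nat)
    (psi : nat -> tpoly gamma) (delta : nat -> nat -> tpoly gamma)
    (hn : (1 <= n)%N) (hU : admissible psi delta n) :
  exists (D : forall l : nat,
            'M[tpoly gamma]_(dual_dim (triangular psi delta l)))
         (S : forall k : nat,
            'M[tpoly gamma]_(dual_dim ((psi k)%:M : 'M[tpoly gamma]_1))),
  (* (i) *)
  [/\ [/\ forall l : nat, (1 <= l <= n)%N -> is_dual (triangular psi delta l) (D l),
          forall k : nat, (1 <= k <= n)%N -> is_dual (psi k)%:M (S k) /\ tau_simple (S k)
        & forall l : nat, (1 <= l)%N -> (l < n)%N ->
          exists i p,
          [/\ dual_induced (triangular psi delta l.+1) (psi l.+1)%:M
                (block_proj gamma l) i,
              dual_induced (triangular psi delta l) (triangular psi delta l.+1)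
                (block_incl gamma l) p
            & short_exact (S l.+1) (D l.+1) (D l) i p]],
  (* (ii) *)
      exists E i p,
      [/\ is_ext (triangular psi delta n) E,
           dual_ext_inclusion (triangular psi delta n) i,
           ext_constant_term (triangular psi delta n) p
        & short_exact (D n) E (Gadd gamma n) i p]
  (* (iii) *)
    & forall (n' : nat) (psi' : nat -> tpoly gamma)
        (delta' : nat -> nat -> tpoly gamma),
      (1 <= n')%N -> admissible psi' delta' n' ->
      forall D' : 'M[tpoly gamma]_(dual_dim (triangular psi' delta' n')),
      is_dual (triangular psi' delta' n') D' ->
      forall f : 'M[tpoly gamma]_(n', n),
      is_morphism (triangular psi delta n) (triangular psi' delta' n') f ->
      exists h, is_morphism D' (D n) h /\ 
        dual_induced (triangular psi delta n) (triangular psi' delta' n') f h].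
Proof.
have [psiD _ psi_rk] := hU.
have Tgood l : (l <= n)%N -> good_triangular (triangular psi delta l).
  exact: triangular_good hU.
have psi_good k : (1 <= k <= n)%N -> good_triangular ((psi k)%:M : 'M_1).
  by move=> kn; apply: scalar_good; [apply: psiD | apply: psi_rk].
(* The family must be defined for every [l]; 0 is a default value beyond [n]. *)
have Dex l : {D : 'M_(dual_dim (triangular psi delta l)) |
    (l <= n)%N -> is_dual (triangular psi delta l) D}.
  case: (boolP (l <= n)%N) => [/Tgood/dual_exists [D DP] | _]; first by exists D.
  by exists 0.
pose D l := sval (Dex l).
have DP l : (l <= n)%N -> is_dual (triangular psi delta l) (D l).
  exact: (svalP (Dex l)).
(* The dual of psi_k is taken in explicit form, since its simplicity is read off from the weights of
   its entries. *)
pose S k := drinfeld_dual (psi k) (dual_dim ((psi k)%:M : 'M_1)).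
have SP k : (1 <= k <= n)%N -> is_dual (psi k)%:M (S k).
  move=> kn; have [psi0 _] := psiD k kn.
  apply: is_dual_intro (psi_good k kn) _ _ => [|L gammaL j eL x].
    by apply/matrixP => a b; rewrite mxE tcoef_drinfeld_dual !mxE.
  exact (drinfeld_dual_action eL psi0 (psi_rk k kn) x).
exists D, S; split.
- split=> [l /andP[_ /DP] // | k kn | l l_gt0 lt_ln].
    split; first exact: SP.
    apply/raises_weight_simple/drinfeld_dual_raises.
    by apply: ltnW; apply: psi_rk.
  have kn : (1 <= l.+1 <= n)%N by [].
  have [i iP] := dual_induced_exists (psi l.+1)%:M (block_proj gamma l) (Tgood _ lt_ln).
  have [p pP] := dual_induced_exists (triangular psi delta l.+1) (block_incl gamma l)
    (Tgood _ (ltnW lt_ln)).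
  exists i, p; split=> //.
  apply: (dual_block_exact (psi_good _ kn) (Tgood _ lt_ln) (Tgood _ (ltnW lt_ln))) iP pP.
  + by rewrite /diag_rank !mxE !eqxx mulr1n subn0.
  + by move=> b; rewrite /diag_rank !mxE !eqxx subSS.
  + exact: triangular_proj.
  + exact: triangular_incl.
  + exact: SP.
  + exact: DP.
  + by apply: DP; apply: ltnW.
- exact: ext_sequence (Tgood _ (leqnn n)) (DP _ (leqnn n)).
- move=> n' psi' delta' _ _ D' D'P f fT.
  have [h hP] := dual_induced_exists (triangular psi' delta' n') f (Tgood _ (leqnn n)).
  exists h; split=> //.
  exact: dual_induced_morphism (Tgood _ (leqnn n)) (DP _ (leqnn n)) D'P fT hP.
Qed.
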